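(* Suppose $s\geq 2$ and $q\geq 0$ are integers satisfying $\operatorname{ex}_{\Pi}\big(s,q+\binom{s}{2}\big)>1$. Then for all $\epsilon>0$ there is $\beta>0$ such that for all sufficiently large $n$, $$ \frac{|F(n,s,q)\setminus E(n,s,q,\epsilon)|}{|F(n,s,q)|}\leq 2^{-\beta n^2}. $$
   Context: For a set $X$ and a positive integer $t$, $\binom{X}{t}$ is the set of $t$-element subsets of $X$; $[n]=\{1,\dots,n\}$; $\mathbb{N}=\{0,1,2,\dots\}$. A multigraph is a pair $G=(V,w)$ where $V$ is a (finite) set of vertices and $w:\binom{V}{2}\to\mathbb{N}$ (the multiplicity function). For integers $s\ge 2$, $q\ge 0$, $G=(V,w)$ is an $(s,q)$-graph if $\sum_{xy\in\binom{X}{2}}w(xy)\le q$ for every $X\in\binom{V}{s}$. $F(n,s,q)$ is the set of $(s,q)$-graphs with vertex set $[n]$. Let $P(G)=\prod_{xy\in\binom{V}{2}}w(xy)$, and $\operatorname{ex}_{\Pi}(n,s,q)=\max\{P(G):G\in F(n,s,q)\}$ for $n\ge s$. For $q\ge\binom{s}{2}$, $\operatorname{ex}_{\Pi}(s,q)=\lim_{n\to\infty}\operatorname{ex}_{\Pi}(n,s,q)^{1/\binom{n}{2}}$ (this limit exists). If $G=(V,w)$ and $G'=(V,w')$ are multigraphs on the same vertex set, $G$ is a submultigraph of $G'$ if $w(xy)\le w'(xy)$ for all $xy\in\binom{V}{2}$. $G^+=(V,w^+)$ where $w^+(xy)=w(xy)+1$ for all $xy$. For $\epsilon>0$ set $$\mathbb{E}(n,s,q,\epsilon)=\Big\{G\in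 F(n,s,q): P(G^+)>\operatorname{ex}_{\Pi}\Big(s,q+\binom{s}{2}\Big)^{(1-\epsilon)\binom{n}{2}}\Big\},$$ and let $E(n,s,q,\epsilon)$ be the set of $G\in F(n,s,q)$ such that $G$ is a submultigraph of some $G'\in\mathbb{E}(n,s,q,\epsilon)$. *)

(* Defs.v *)
From HB Require Import structures.
From mathcomp Require Import all_boot all_order all_algebra finmap.
From mathcomp Require Import all_classical all_reals all_analysis.

Set Implicit Arguments.
Unset Strict Implicit.
Unset Printing Implicit Defensive.

Import Order.TTheory GRing.Theory Num.Theory.
Import numFieldNormedType.Exports.

Local Open Scope classical_set_scope.
Local Open Scope ring_scope.

Definition pairs (V : finType) := {e : {set V} | #|e| == 2%N}.

(* A multigraph is identified with its multiplicity function. *)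
Definition multigraph (V : finType) := {ffun pairs V -> nat}.

Definition weight_in (V : finType) (G : multigraph V) (X : {set V}) : nat :=
  (\sum_(e : pairs V | val e \subset X) G e)%N.

Definition is_sq_graph (s q : nat) (V : finType) (G : multigraph V) : Prop :=
  forall X : {set V}, #|X| = s -> (weight_in G X <= q)%N.

(* The vertex set {1, ..., n} is represented by 'I_n = {0, ..., n - 1}. *)
Definition sq_graphs (n s q : nat) : set (multigraph 'I_n) :=
  [set G | is_sq_graph s q G].
Arguments sq_graphs : clear implicits.

Definition mg_prod (V : finType) (G : multigraph V) : nat :=
  (\prod_(e : pairs V) G e)%N.

Definition submultigraph (V : finType) (G G' : multigraph V) : Prop :=
  forall e : pairs V, (G e <= G' e)%N.

Definition mg_plus (V : finType) (G : multigraph V) : multigraph V :=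
  [ffun e => (G e).+1].

(* [fset_set A] enumerates A when A is finite and is empty otherwise.
   By [finite_sq_graphs] below, every set of (s,q)-graphs on 'I_n is finite
   as soon as 2 <= s <= n. *)
Definition card_set (T : choiceType) (A : set T) : nat :=
  #|` fset_set A|%fset.

(* Meaningful only when 2 <= s <= n; the family is then finite, and nonempty
   since it contains the zero multigraph. *)
Definition ex_prod (n s q : nat) : nat :=
  (\max_(G <- fset_set (sq_graphs n s q)) mg_prod G)%N.

(* [limn] is total; the limit is known to exist for 'C(s, 2) <= q, the only
   case in which this value is used. *)
Definition ex_prod_lim (R : realType) (s q : nat) : R :=
  limn (fun n : nat => (ex_prod n s q)%:R `^ ('C(n, 2)%:R^-1)).

Definition near_ex_graphs (R : realType) (n s q : nat) (eps : R) :
    set (multigraph 'I_n) :=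
  [set G | sq_graphs n s q G /\
    ex_prod_lim R s (q + 'C(s, 2)) `^ ((1 - eps) * 'C(n, 2)%:R)
      < (mg_prod (mg_plus G))%:R].
Arguments near_ex_graphs {R} n s q eps _.

Definition sub_near_ex_graphs (R : realType) (n s q : nat) (eps : R) :
    set (multigraph 'I_n) :=
  [set G | sq_graphs n s q G /\
    exists2 G', near_ex_graphs n s q eps G' & submultigraph G G'].
Arguments sub_near_ex_graphs {R} n s q eps _.

Lemma superset_card (T : finType) (A : {set T}) (s : nat) :
  (#|A| <= s)%N -> (s <= #|T|)%N ->
  exists2 X : {set T}, A \subset X & #|X| = s.
Proof.
move=> As sT; pose B := [set x in take (s - #|A|) (enum (~: A))].
have cB : #|B| = (s - #|A|)%N.
  rewrite cardsE (card_uniqP _) ?take_uniq ?enum_uniq// size_takel//.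
  by rewrite -cardE -(leq_add2l #|A|) subnKC ?cardsC.
exists (A :|: B); first exact: finset.subsetUl.
rewrite cardsU cB (_ : A :&: B = finset.set0) ?cards0 ?subn0 ?subnKC//.
apply/setP => x; rewrite !inE; apply/negbTE/negP => /andP[xA /mem_take].
by rewrite mem_enum inE xA.
Qed.

Lemma finite_sq_graphs (n s q : nat) : (2 <= s <= n)%N ->
  finite_set (sq_graphs n s q).
Proof.
move=> /andP[s2 sn].
pose f (g : {ffun pairs 'I_n -> 'I_q.+1}) : multigraph 'I_n :=
  [ffun e => nat_of_ord (g e)].
apply: (@sub_finite_set _ _ (f @` setT)); last first.
  by apply: finite_image; exact: finite_finset.
move=> G FG; exists [ffun e => inord (G e)] => //.
apply/ffunP => e; rewrite !ffunE inordK// ltnS.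
have [||X eX cX] := @superset_card _ (val e) s.
- by rewrite (eqP (valP e)).
- by rewrite card_ord.
- by apply: leq_trans (FG X cX); rewrite /weight_in (bigD1 e)//= leq_addr.
Qed.

(* Main.v *)
Require Import Defs.
From HB Require Import structures.
From mathcomp Require Import all_boot all_order all_algebra finmap.
From mathcomp Require Import all_classical all_reals all_analysis.
From mathcomp Require Import ring lra zify.
Import Order.TTheory GRing.Theory Num.Theory.
Import numFieldNormedType.Exports.

(** Write [pi] for [ex_prod_lim R s (q + 'C(s, 2))], [N] for ['C(n, 2)], and
    call the set of submultigraphs of [C] the box of [C]; its size is
    [P(C^+)].

    Lowering all multiplicities of a product-extremal graph by one gives an
    (s,q)-graph whose whole box consists of (s,q)-graphs, so there are at least
    [pi ^ ((1 - o(1)) * N)] of them ([ex_prod_le_card]).  The (s,q)-graphs that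
    are not below a near-extremal one are shown to be exponentially fewer, in
    two steps.

    Containers ([container_theorem]).  All (s,q)-graphs are covered by
    [2 ^ (o(n^2))] boxes, each of size at most [pi ^ ((1 + o(1)) * N)].  Given
    [G], the weak regularity lemma of Frieze and Kannan ([weak_regularity])
    approximates the indicators of the events that the multiplicity is at least
    [v] by functions constant on the blocks of a partition of the vertices into
    boundedly many classes.  The template of [G] takes on each block the largest
    [v] reached with density at least a small constant [eta].  It depends only
    on the partition and on a bounded table, it dominates [G] outside few pairs,
    where the values of [G] are recorded explicitly, and by the counting lemma
    ([counting_lemma]) nearly all maps from a fixed set of [m] vertices pull it
    back to an (s,q)-graph, since otherwise [G] itself would contain a
    forbidden pattern.  Averaging the logarithm of the box size over these maps
    bounds it by its extremal value on [m] vertices ([template_weight]).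

    Inside one container [C] ([stuck_below_count]).  If [C] is not an
    (s,q)-graph, then some set of at most ['C(s, 2)] pairs witnesses this, and
    every (s,q)-graph in the box differs from [C] on these pairs, which excludes
    a fixed fraction of the box.  Fixing the values on these pairs and repeating
    gives a decision tree.  A branch that stops after fewer than [p] rounds has
    reached an (s,q)-graph that lies above everything in its subbox and whose own
    box is smaller than that of [C] by a factor of at most [B ^ ('C(s, 2) * p)];
    the branches of length [p] carry an exponentially small proportion of the
    box.  With [p] a small multiple of [n ^ 2], either the box of [C] is itself
    small, or all (s,q)-graphs in it outside an exponentially small proportion
    lie below a near-extremal one. *)

Set Implicit Arguments.
Unset Strict Implicit.

(** * Counting the members of a local family inside a box *)

Section LocalFamilies.
Local Open Scope nat_scope.
Variables (I : finType) (q : nat).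
Implicit Types (G C : {ffun I -> 'I_q.+1}) (W S : {set I}).

(** Pointwise order. *)
Definition below G C := [forall i, G i <= C i].

(** Equality on the coordinates in [S]. *)
Definition agree S G C := [forall (i | i \in S), G i == C i].

(** The number of functions below [C], i.e. the product [P(C^+)]. *)
Definition boxsize C := \prod_i (C i).+1.

(** The functions below [C] that coincide with [C] on [W]. *)
Definition face C W : {set {ffun I -> 'I_q.+1}} :=
  [set G | below G C && agree W G C].

(** [C] on the coordinates in [S], and [G] elsewhere. *)
Definition splice S C G : {ffun I -> 'I_q.+1} :=
  [ffun i => if i \in S then C i else G i].

Lemma belowP G C : reflect (forall i, G i <= C i) (below G C).
Proof. exact: forallP. Qed.

Lemma agreeP S G C : reflect (forall i, i \in S -> G i = C i) (agree S G C).
Proof.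
apply: (iffP forall_inP) => h i iS; first exact/eqP/h.
by apply/eqP/h.
Qed.

Lemma face0 C : face C finset.set0 = [set G | below G C].
Proof.
apply/finset.setP => G; rewrite !inE; case: below => //=.
by apply/agreeP => i; rewrite inE.
Qed.

Lemma card_below C : #|[set G | below G C]| = boxsize C.
Proof.
have -> : #|[set G | below G C]| = #|family (fun i => [pred v : 'I_q.+1 | v <= C i])|.
  by apply: eq_card => G; rewrite !inE; apply/belowP/familyP => h i; have := h i; rewrite inE.
rewrite card_family foldrE big_image /boxsize; apply: eq_bigr => i _.
rewrite -sum1_card -(big_mkord (fun v => v < (C i).+1) (fun=> 1)).
rewrite -(@big_nat_widen _ _ _ 0 (C i).+1 q.+1 xpredT (fun=> 1)) ?ltn_ord//.
by rewrite sum_nat_const_nat subn0 muln1.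
Qed.

Variables (R B : nat) (F : {set {ffun I -> 'I_q.+1}}).
Hypotheses (qB : q < B)
  (Floc : forall C, C \notin F -> exists2 S : {set I}, #|S| <= R &
            forall G, agree S G C -> G \notin F).

(** The members [G] of [F] such that no member of [F] above [G] has a box of
    size at least [B ^- k] times that of [C]. *)
Definition stuck C (k : nat) : {set {ffun I -> 'I_q.+1}} :=
  [set G in F | ~~ [exists G' in F,
     below G G' && (boxsize C <= boxsize G' * B ^ k)]].

(** A member of a face is determined by its values on [S :\: W], encoded as the
    function [splice S G C], and by its position in the corresponding subface. *)
Lemma face_split C W S G :
  (G \in face C W) =
  (splice S G C \in face C (~: (S :\: W))) && (G \in face (splice S G C) (W :|: S)) .
Proof.
rewrite !inE; apply/idP/idP.
  move=> /andP[/belowP b /agreeP a]; apply/andP; split; apply/andP; split.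
  - by apply/belowP => i; rewrite ffunE; case: ifP.
  - apply/agreeP => i; rewrite !inE ffunE; case: ifP => //.
    by rewrite andbT negbK => iS iW; exact: a.
  - by apply/belowP => i; rewrite ffunE; case: ifP.
  - by apply/agreeP => i; rewrite !inE ffunE; case: ifP => //; rewrite orbF => _; exact: a.
move=> /andP[/andP[/belowP b1 /agreeP a1] /andP[/belowP b2 /agreeP a2]].
apply/andP; split.
  by apply/belowP => i; exact: leq_trans (b2 i) (b1 i).
apply/agreeP => i iW; rewrite a2 ?inE ?iW//.
by apply: a1; rewrite !inE iW.
Qed.

Lemma face_partition C W S (A : {set {ffun I -> 'I_q.+1}}) :
  #|A :&: face C W| =
  \sum_(J in face C (~: (S :\: W))) #|A :&: face J (W :|: S)|.
Proof.
rewrite -sum1_card (partition_big (fun G => splice S G C)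
  (mem (face C (~: (S :\: W))))) /=; last first.
  by move=> G; rewrite inE (face_split _ _ S) => /andP[_ /andP[]].
apply: eq_bigr => J JC; rewrite -sum1_card; apply: eq_bigl => G.
have inI (X Y : {set {ffun I -> 'I_q.+1}}) : (G \in X :&: Y) = (G \in X) && (G \in Y) by rewrite inE.
rewrite !inI (face_split C W S) -andbA; case: (G \in A) => //=.
apply/idP/idP => [/andP[/andP[_ h] /eqP <-] //|h].
suff e : splice S G C = J by rewrite e JC h eqxx.
move: JC h; rewrite !inE => /andP[_ /agreeP a] /andP[_ /agreeP a'].
apply/ffunP => i; rewrite ffunE; case: ifP => iS; first by rewrite a'// inE iS orbT.
by rewrite a// !inE iS andbF.
Qed.

Lemma card_face_le C W S J : J \in face C (~: (S :\: W)) ->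
  #|face J (W :|: S)| <= #|face C (W :|: S)|.
Proof.
rewrite inE => /andP[/belowP bJ /agreeP aJ].
have inj : {in face J (W :|: S) &, injective (splice (S :\: W) C)}.
  move=> G G'; rewrite !inE => /andP[_ /agreeP a] /andP[_ /agreeP a'] /ffunP e.
  apply/ffunP => i; have [iS|/negbTE iS] := boolP (i \in S).
    by rewrite a ?a'// inE iS orbT.
  by have := e i; rewrite !ffunE !inE iS andbF.
rewrite -(card_in_imset inj); apply/subset_leq_card/fintype.subsetP => _ /imsetP[G GJ ->].
move: GJ; rewrite !inE => /andP[/belowP b /agreeP a]; apply/andP; split.
  apply/belowP => i; rewrite ffunE; case: ifP => // _.
  exact: leq_trans (b i) (bJ i).
apply/agreeP => i; rewrite ffunE => iWS; case: ifP => // /negbT iS.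
by rewrite a// aJ// inE.
Qed.

Lemma card_face_fiber C W S : #|S| <= R -> #|face C (~: (S :\: W))| <= B ^ R.
Proof.
move=> SR.
have inj : {in face C (~: (S :\: W)) &,
    injective (fun G => [ffun x : {x | x \in S} => G (val x)])}.
  move=> G G'; rewrite !inE => /andP[_ /agreeP a] /andP[_ /agreeP a'] /ffunP e.
  apply/ffunP => i; have [iS|iS] := boolP (i \in S).
    by have := e (exist _ i iS); rewrite !ffunE.
  by rewrite a ?a'// !inE (negbTE iS) andbF.
rewrite -(card_in_imset inj).
apply: (leq_trans (max_card _)); rewrite card_ffun card_ord card_sig.
apply: (@leq_trans (q.+1 ^ R)); first by rewrite leq_pexp2l.
by case: (R) => [|r]; rewrite ?expn0// leq_exp2r.
Qed.

Lemma boxsize_fiber C W S J : #|S| <= R -> J \in face C (~: (S :\: W)) ->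
  boxsize C <= boxsize J * B ^ R.
Proof.
move=> SR; rewrite inE => /andP[/belowP bJ /agreeP aJ].
apply: (@leq_trans (boxsize J * B ^ #|S|)); last first.
  by rewrite leq_pmul2l ?prodn_gt0// leq_pexp2l// (leq_trans _ qB).
rewrite -prod_nat_const big_mkcond /boxsize -big_split /=.
apply: leq_prod => i _; case: ifP => iS.
  by rewrite (leq_trans (ltn_ord (C i)))// (leq_trans qB) ?leq_pmull.
by rewrite muln1 aJ// !inE iS andbF.
Qed.

(** A decision tree of depth at most [p]: as long as the current box is not a
    member of [F], some [S] of size at most [R] witnesses it, and no member of
    [F] agrees with [C] on [S]; branching on the other values on [S] loses a
    fraction of at least [B ^- R] of the box.  When the current box is a member
    of [F], it lies above everything in it, and at most [B ^ (R * p)] of the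
    size has been lost. *)
Lemma stuck_count p C W :
  #|stuck C (R * p) :&: face C W| * (B ^ R) ^ p <=
  #|face C W| * (B ^ R).-1 ^ p.
Proof.
elim: p C W => [|p IH] C W.
  by rewrite !expn0 !muln1 subset_leq_card// finset.subsetIr.
have B0 : 0 < B by rewrite (leq_trans _ qB).
have [CF|/Floc[S SR nF]] := boolP (C \in F).
  rewrite (_ : _ :&: _ = finset.set0) ?cards0//.
  apply/finset.setP => G; rewrite !inE; apply/negbTE.
  apply/negP => /andP[/andP[_ /negP nex] /andP[GC _]]; apply: nex.
  by apply/existsP; exists C; rewrite CF GC leq_pmulr// expn_gt0 B0.
rewrite (face_partition _ _ S).
have CC : C \in face C (~: (S :\: W)).
  by rewrite inE; apply/andP; split; [apply/belowP|apply/agreeP].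
set k := R * p.+1.
have C0 : #|stuck C k :&: face C (W :|: S)| = 0.
  apply/eqP; rewrite cards_eq0; apply/eqP/finset.setP => G; rewrite !inE.
  apply/negbTE/negP => /andP[/andP[GF _] /andP[_ /agreeP a]].
  by have := nF G; rewrite GF => /(_ _)/negP; apply => //; apply/agreeP => i iS;
    rewrite a// inE iS orbT.
rewrite (bigD1 C)//= C0 add0n.
have step : (\sum_(J in face C (~: (S :\: W)) | J != C)
      #|stuck C k :&: face J (W :|: S)|) * (B ^ R) ^ p <=
    (\sum_(J in face C (~: (S :\: W)) | J != C) #|face J (W :|: S)|)
      * (B ^ R).-1 ^ p.
  rewrite !big_distrl /=; apply: leq_sum => J /andP[JC _].
  apply: leq_trans (IH J (W :|: S)); rewrite leq_mul2r; apply/orP; right.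
  apply/subset_leq_card/finset.setSI/fintype.subsetP => G; rewrite !inE => /andP[-> /=].
  apply: contra => /existsP[G' /andP[G'F /andP[GG' h]]].
  apply/existsP; exists G'; rewrite G'F GG' /=.
  apply: leq_trans (boxsize_fiber SR JC) _.
  by rewrite /k mulnS addnC expnD mulnA leq_mul2r h orbT.
have T1 : #|face C W| = #|face C (W :|: S)| +
    \sum_(J in face C (~: (S :\: W)) | J != C) #|face J (W :|: S)|.
  rewrite -[face C W]finset.setTI (face_partition _ _ S) (bigD1 C)//= finset.setTI.
  by congr (_ + _); apply: eq_bigr => J _; rewrite finset.setTI.
have T2 : #|face C W| <= B ^ R * #|face C (W :|: S)|.
  rewrite -[face C W]finset.setTI (face_partition _ _ S).
  apply: (@leq_trans (\sum_(J in face C (~: (S :\: W))) #|face C (W :|: S)|)).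
    by apply: leq_sum => J JC; rewrite finset.setTI; exact: card_face_le JC.
  by rewrite sum_nat_const leq_mul2r card_face_fiber ?orbT.
rewrite [in X in X <= _]expnS [in X in _ <= X]expnS.
move: step T1 T2; set a := \sum_(J in _ | _) _; set b := \sum_(J in _ | _) _.
set t := #|face C (W :|: S)|; set x := (B ^ R) ^ p; set y := _ ^ p.
have : 0 < B ^ R by rewrite expn_gt0 B0.
case: (B ^ R) => // D _ /= le1 -> le2.
rewrite mulnCA mulnA.
apply: (@leq_trans (D.+1 * (b * y))); first by rewrite -mulnA leq_mul2l le1 orbT.
by rewrite !mulnA leq_mul2r; apply/orP; right; nia.
Qed.

(** All but a proportion of [(1 - B ^- R) ^ p] of the functions below [C] are
    outside [F] or lie below a member of [F] whose box is almost as large. *)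
Lemma stuck_below_count p C :
  #|[set G in stuck C (R * p) | below G C]| * (B ^ R) ^ p <=
  boxsize C * (B ^ R).-1 ^ p.
Proof.
have := stuck_count p C finset.set0; rewrite face0 card_below; apply: leq_trans.
by rewrite leq_mul2r (@eq_leq _ _ _) ?orbT//; apply: eq_card => G; rewrite !inE.
Qed.

End LocalFamilies.

(** * Weak regularity *)

Section BlockAverages.
Local Open Scope ring_scope.
Variables (R : realType) (V : finType).
Implicit Types (l : V -> nat) (u : V -> R) (h D : V -> V -> R).

(** The average of [u] over the class of [x] in the partition of [V] into the
    fibres of [l]. *)
Definition class_mean l u (x : V) : R :=
  (\sum_(a | l a == l x) u a) / #|[pred a | l a == l x]|%:R.

(** The average of [h] over the block of [(x, y)], i.e. the conditional
    expectation of [h] on the product partition. *)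
Definition block_mean l h (x y : V) : R :=
  class_mean l (fun a => class_mean l (h a) y) x.

Lemma class_card_gt0 l x : (0 : R) < #|[pred a | l a == l x]|%:R.
Proof. by rewrite ltr0n; apply/card_gt0P; exists x; rewrite inE. Qed.

Lemma class_meanS l u x x' : l x = l x' -> class_mean l u x = class_mean l u x'.
Proof. by rewrite /class_mean => ->. Qed.

Lemma class_mean_ge0 l u x : (forall a, 0 <= u a) -> 0 <= class_mean l u x.
Proof. by move=> u0; rewrite divr_ge0 ?ler0n// sumr_ge0. Qed.

Lemma class_mean_le1 l u x : (forall a, u a <= 1) -> class_mean l u x <= 1.
Proof.
move=> u1; rewrite ler_pdivrMr ?class_card_gt0// mul1r -sum1_card natr_sum.
exact: ler_sum.
Qed.

(** Averaging over classes is self-adjoint and fixes functions that are constant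
    on the classes. *)
Lemma class_mean_proj l u phi : (forall x x', l x = l x' -> phi x = phi x') ->
  \sum_x phi x * class_mean l u x = \sum_x phi x * u x.
Proof.
move=> phil; rewrite /class_mean.
under eq_bigr do rewrite mulr_suml mulr_sumr.
rewrite (exchange_big_dep xpredT)//=; apply: eq_bigr => a _.
rewrite (eq_bigr (fun=> phi a * u a / #|[pred b | l b == l a]|%:R)); last first.
  by move=> x /eqP e; rewrite (phil x a)// -e mulrA.
rewrite (eq_bigl [pred b | l b == l a]) => [|x]; last by rewrite /= eq_sym.
by rewrite sumr_const -[LHS]mulr_natr mulfVK// gt_eqF// class_card_gt0.
Qed.

Lemma block_meanS l h x x' y y' : l x = l x' -> l y = l y' ->
  block_mean l h x y = block_mean l h x' y'.
Proof.
move=> ex ey; rewrite /block_mean (class_meanS _ ex) /class_mean.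
by rewrite !ey.
Qed.

Lemma block_mean_ge0 l h x y : (forall a b, 0 <= h a b) -> 0 <= block_mean l h x y.
Proof. by move=> h0; do 2!apply: class_mean_ge0 => ?. Qed.

Lemma block_mean_le1 l h x y : (forall a b, h a b <= 1) -> block_mean l h x y <= 1.
Proof. by move=> h1; do 2!apply: class_mean_le1 => ?. Qed.

Lemma block_mean_sym l h x y : (forall a b, h a b = h b a) ->
  block_mean l h x y = block_mean l h y x.
Proof.
move=> hs; rewrite /block_mean /class_mean -!mulr_suml exchange_big /=.
rewrite -!mulrA [_^-1 * _]mulrC; congr (_ * _).
by apply: eq_bigr => a _; apply: eq_bigr => b _.
Qed.

Lemma block_mean_proj l h phi :
  (forall x x' y y', l x = l x' -> l y = l y' -> phi x y = phi x' y') ->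
  \sum_x \sum_y phi x y * block_mean l h x y = \sum_x \sum_y phi x y * h x y.
Proof.
move=> phil; transitivity (\sum_x \sum_y phi x y * class_mean l (h x) y).
  rewrite exchange_big [RHS]exchange_big /=; apply: eq_bigr => y _.
  rewrite /block_mean (@class_mean_proj l _ (fun x => phi x y))// => x x' e.
  exact: phil.
apply: eq_bigr => x _.
by rewrite (@class_mean_proj l _ (phi x))// => y y' e; exact: phil.
Qed.

(** [D] has cut norm at most [e], normalised by the number of ordered pairs. *)
Definition cut_le D (e : R) := forall A B : {set V},
  `|\sum_(x in A) \sum_(y in B) D x y| <= e * #|V|%:R ^+ 2.

Lemma sum_weight_le (u c : V -> R) : (forall x, 0 <= u x <= 1) ->
  \sum_x u x * c x <= \sum_(x in [set x | 0 < c x]) c x.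
Proof.
move=> u01; rewrite [leRHS]big_mkcond /=; apply: ler_sum => x _.
have /andP[u0 u1] := u01 x.
rewrite inE; case: ltP => c0; first by rewrite ler_piMl// ltW.
exact: mulr_ge0_le0.
Qed.

(** By bilinearity, the cut norm also controls test functions with values in
    [0, 1]. *)
Lemma cut_le_fun D e (u u' : V -> R) : cut_le D e ->
  (forall x, 0 <= u x <= 1) -> (forall y, 0 <= u' y <= 1) ->
  `|\sum_x \sum_y u x * u' y * D x y| <= e * #|V|%:R ^+ 2.
Proof.
have one D' : cut_le D' e -> (forall x, 0 <= u x <= 1) ->
    (forall y, 0 <= u' y <= 1) ->
    \sum_x \sum_y u x * u' y * D' x y <= e * #|V|%:R ^+ 2.
  move=> De u01 u'01.
  under eq_bigr => x _ do under eq_bigr => y _ do rewrite -mulrA.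
  under eq_bigr => x _ do rewrite -mulr_sumr.
  apply: le_trans (sum_weight_le _ u01) _.
  set A := [set x | _]; rewrite exchange_big /=.
  under eq_bigr => y _ do rewrite -mulr_sumr.
  apply: le_trans (sum_weight_le _ u'01) _.
  set B := [set y | _]; rewrite exchange_big /=.
  exact: le_trans (ler_norm _) (De A B).
move=> De u01 u'01; rewrite ler_norml one// andbT lerNl.
rewrite -sumrN; under eq_bigr do rewrite -sumrN.
under eq_bigr => x _ do under eq_bigr => y _ do rewrite -mulrN.
apply: (one (fun x y => - D x y)) => // A B.
by under eq_bigr do rewrite sumrN; rewrite sumrN normrN.
Qed.

Section Energy.
Variables (J : finType) (h : J -> V -> V -> R).

(** The energy of the partition into the fibres of [l]. *)
Definition energy l : R := \sum_j \sum_x \sum_y block_mean l (h j) x y ^+ 2.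

(** Every fibre of [l'] lies in a fibre of [l]. *)
Definition refines l' l := forall x y, l' x = l' y -> l x = l y.

(** Pythagoras: the block means over [l] are the orthogonal projection of those
    over any refinement. *)
Lemma block_mean_refine l l' j : refines l' l ->
  \sum_x \sum_y block_mean l' (h j) x y ^+ 2 =
  \sum_x \sum_y block_mean l (h j) x y ^+ 2 +
  \sum_x \sum_y (block_mean l' (h j) x y - block_mean l (h j) x y) ^+ 2.
Proof.
move=> ll'.
set f := block_mean l (h j); set f' := block_mean l' (h j).
have ff' : \sum_x \sum_y f x y * f' x y = \sum_x \sum_y f x y * f x y.
  rewrite [LHS]block_mean_proj; last first.
    by move=> x x' y y' /ll' ex /ll' ey; exact: block_meanS.
  by rewrite [RHS]block_mean_proj//; exact: block_meanS.
have -> : \sum_x \sum_y (f' x y - f x y) ^+ 2 =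
    \sum_x \sum_y f' x y ^+ 2 + (\sum_x \sum_y f x y ^+ 2
      - 2 * \sum_x \sum_y f x y * f' x y).
  rewrite mulr_sumr -sumrB -big_split /=; apply: eq_bigr => x _.
  rewrite mulr_sumr -sumrB -big_split /=; apply: eq_bigr => y _; ring.
have -> : \sum_x \sum_y f x y * f' x y = \sum_x \sum_y f x y ^+ 2.
  by rewrite ff'; apply: eq_bigr => x _; apply: eq_bigr => y _.
ring.
Qed.

(** Refining by a pair of sets that violates the cut-norm bound increases the
    energy by a definite amount. *)
Lemma energy_increment l l' j (A B : {set V}) (e : R) : 0 < e -> refines l' l ->
  (forall x y, l' x = l' y -> (x \in A) = (y \in A)) ->
  (forall x y, l' x = l' y -> (x \in B) = (y \in B)) ->
  e * #|V|%:R ^+ 2 <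
    `|\sum_(x in A) \sum_(y in B) (h j x y - block_mean l (h j) x y)| ->
  energy l + e ^+ 2 * #|V|%:R ^+ 2 <= energy l'.
Proof.
move=> e0 ll' lA lB big.
have -> : energy l' = energy l + \sum_i \sum_x \sum_y
    (block_mean l' (h i) x y - block_mean l (h i) x y) ^+ 2.
  by rewrite /energy -big_split; apply: eq_bigr => i _; exact: block_mean_refine.
rewrite lerD2l (bigD1 j)//=; set s := (X in _ <= X + _).
suff : e ^+ 2 * #|V|%:R ^+ 2 <= s.
  by move=> /le_trans; apply; rewrite lerDl; do 3!apply: sumr_ge0 => ? _; exact: sqr_ge0.
pose chi x y : R := ((x \in A) && (y \in B))%:R.
pose D x y := block_mean l' (h j) x y - block_mean l (h j) x y.
have chiD (E : V -> V -> R) :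
    \sum_x \sum_y chi x y * E x y = \sum_(x in A) \sum_(y in B) E x y.
  rewrite [RHS]big_mkcond /=; apply: eq_bigr => x _; rewrite [in RHS]big_mkcond /= /chi.
  case: (x \in A); last by rewrite big1// => y _; rewrite mul0r.
  by apply: eq_bigr => y _; case: (y \in B); rewrite /= ?mul1r ?mul0r.
set d := \sum_(x in A) _ in big.
have dE : \sum_x \sum_y chi x y * D x y = d.
  rewrite /d -chiD.
  under eq_bigr => x _ do under eq_bigr => y _ do rewrite mulrBr.
  under [RHS]eq_bigr => x _ do under eq_bigr => y _ do rewrite mulrBr.
  under eq_bigr => x _ do rewrite sumrB.
  under [RHS]eq_bigr => x _ do rewrite sumrB.
  rewrite !sumrB; congr (_ - _); apply: block_mean_proj.
  by move=> x x' y y' ex ey; rewrite /chi (lA _ _ ex) (lB _ _ ey).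
(* Nonnegativity of the sum of squares of [D - t * chi]; [t = e] or [t = - e]
   according to the sign of [d] gives the bound. *)
have key (t : R) : 2 * t * d - t ^+ 2 * #|V|%:R ^+ 2 <= s.
  have -> : 2 * t * d = \sum_x \sum_y 2 * t * (chi x y * D x y).
    by rewrite -dE mulr_sumr; apply: eq_bigr => x _; rewrite mulr_sumr.
  have -> : t ^+ 2 * #|V|%:R ^+ 2 = \sum_(x : V) \sum_(y : V) t ^+ 2.
    by rewrite 2!sumr_const -mulrnA -[RHS]mulr_natr natrM [#|V|%:R ^+ 2]expr2.
  rewrite -sumrB; apply: ler_sum => x _; rewrite -sumrB; apply: ler_sum => y _.
  rewrite -/(D x y) /chi; move: (D x y) => z.
  have := sqr_ge0 (z - t); have := sqr_ge0 z; have := sqr_ge0 t.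
  by case: (_ && _); rewrite /= ?mulr1n ?mulr0n ?mul1r ?mul0r; nra.
move: big; case: (ler0P d) => d0 big.
  by apply: le_trans (key (- e)); nra.
by apply: le_trans (key e); nra.
Qed.

End Energy.
End BlockAverages.

Section WeakRegularity.
Local Open Scope ring_scope.
Variables (R : realType) (V J : finType) (h : J -> V -> V -> R).
Hypothesis h01 : forall j x y, 0 <= h j x y <= 1.

Lemma energy_le l : energy h l <= #|J|%:R * #|V|%:R ^+ 2.
Proof.
have -> : #|J|%:R * #|V|%:R ^+ 2 = \sum_(j : J) \sum_(x : V) \sum_(y : V) (1 : R).
  by rewrite 3!sumr_const -2!mulrnA !natrM; ring.
apply: ler_sum => j _; apply: ler_sum => x _; apply: ler_sum => y _.
by rewrite expr_le1// ?block_mean_le1 ?block_mean_ge0// => a b; have /andP[] := h01 j a b.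
Qed.

Lemma weak_regularity_step (e : R) (k : nat) : 0 < e ->
  exists l : V -> nat, (forall x, (l x < 4 ^ k)%N) /\
    ((forall j, cut_le (fun x y => h j x y - block_mean l (h j) x y) e) \/
     k%:R * (e ^+ 2 * #|V|%:R ^+ 2) <= energy h l).
Proof.
move=> e0; elim: k => [|k [l [lk [reg|en]]]].
- exists (fun=> 0%N); split => //; right; rewrite mul0r.
  by do 3!apply: sumr_ge0 => ? _; exact: sqr_ge0.
- by exists l; split; [move=> x; rewrite (leq_trans (lk x))// leq_exp2l|left].
have [reg|] := pselect (forall j, cut_le (fun x y => h j x y - block_mean l (h j) x y) e).
  by exists l; split; [move=> x; rewrite (leq_trans (lk x))// leq_exp2l|left].
move=> /existsNP[j /existsNP[A /existsNP[B /negP]]]; rewrite -ltNge => big.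
(* Each class is split into four, according to membership in [A] and [B]. *)
exists (fun x => 4 * l x + (2 * (x \in A) + (x \in B)))%N; split.
  move=> x; have := lk x; rewrite expnS; case: (x \in A); case: (x \in B); lia.
right; rewrite -natr1 mulrDl mul1r.
apply: le_trans (energy_increment (j := j) (A := A) (B := B) e0 _ _ _ big).
- by rewrite lerD2r.
- by move=> x y; case: (x \in A); case: (x \in B); case: (y \in A); case: (y \in B); lia.
- by move=> x y; case: (x \in A); case: (x \in B); case: (y \in A); case: (y \in B); lia.
- by move=> x y; case: (x \in A); case: (x \in B); case: (y \in A); case: (y \in B); lia.
Qed.

(** The weak regularity lemma of Frieze and Kannan, for a finite family of
    functions at once. *)
Lemma weak_regularity (e : R) (k : nat) : 0 < e -> #|J|%:R < k%:R * e ^+ 2 ->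
  exists2 l : V -> nat, forall x, (l x < 4 ^ k)%N &
    forall j, cut_le (fun x y => h j x y - block_mean l (h j) x y) e.
Proof.
move=> e0 Jk; have [l [lk [reg|en]]] := weak_regularity_step k e0; first by exists l.
exists l => // j A B.
have [/card0_eq V0|V0] := posnP #|V|.
  rewrite big1 ?normr0 ?mulr_ge0 ?exprn_ge0 ?(ltW e0)// => x; have := V0 x.
  by rewrite inE.
have := le_trans en (energy_le l); rewrite mulrA ler_pM2r; last first.
  by apply: exprn_gt0; rewrite ltr0n.
by rewrite leNgt Jk.
Qed.

End WeakRegularity.

(** * Counting copies of a pattern in a cut-norm approximation *)

Section Pairs.
Local Open Scope nat_scope.
Variable V : finType.
Implicit Types (e : pairs V).

Lemma pair_endsP e : exists p : V * V, (p.1 != p.2) && (val e == [set p.1; p.2]).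
Proof.
by have /cards2P[x [y [xy ee]]] := valP e; exists (x, y); rewrite xy ee eqxx.
Qed.

(** An arbitrary ordering of the two elements of [e]. *)
Definition ends e : V * V := xchoose (pair_endsP e).

Lemma ends_neq e : (ends e).1 != (ends e).2.
Proof. by have /andP[] := xchooseP (pair_endsP e). Qed.

Lemma val_ends e : val e = [set (ends e).1; (ends e).2].
Proof. by have /andP[_ /eqP] := xchooseP (pair_endsP e). Qed.

Lemma ends1_in e : (ends e).1 \in val e.
Proof. by rewrite val_ends !inE eqxx. Qed.

Lemma ends2_in e : (ends e).2 \in val e.
Proof. by rewrite val_ends !inE eqxx orbT. Qed.

Lemma ends_inj_in e e' : (ends e).1 \in val e' -> (ends e).2 \in val e' -> e = e'.
Proof.
move=> h1 h2; apply/val_inj/eqP; rewrite eqEcard (eqP (valP e)) (eqP (valP e')) leqnn andbT.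
by rewrite val_ends finset.subUset !finset.sub1set h1 h2.
Qed.

(** The multiplicity of a multigraph as a symmetric function of two vertices,
    vanishing on the diagonal. *)
Definition mult (G : multigraph V) (x y : V) : nat :=
  if insub [set x; y] is Some e then G e else 0.

Lemma mult_ends (G : multigraph V) e : mult G (ends e).1 (ends e).2 = G e.
Proof. by rewrite /mult -val_ends valK. Qed.

Lemma mult_sym (G : multigraph V) x y : mult G x y = mult G y x.
Proof. by rewrite /mult finset.setUC. Qed.

Lemma mult_le (G : multigraph V) q x y : (forall e, G e <= q) -> mult G x y <= q.
Proof. by move=> Gq; rewrite /mult; case: insub. Qed.

(** Each unordered pair of vertices occurs as two ordered pairs. *)
Lemma sum_pairs_le (R : realType) (phi : V -> V -> R) :
  (forall x y, 0 <= phi x y)%R -> (forall x y, phi x y = phi y x) ->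
  (2 * (\sum_(e : pairs V) phi (ends e).1 (ends e).2) <= \sum_x \sum_y phi x y)%R.
Proof.
move=> phi0 phis; rewrite pair_big /=.
apply: (@le_trans _ _ (\sum_(e : pairs V)
    \sum_(p : V * V | [set p.1; p.2] == val e) phi p.1 p.2)%R).
  rewrite mulr_sumr; apply: ler_sum => e _.
  rewrite (bigD1 (ends e)) ?val_ends//= (bigD1 ((ends e).2, (ends e).1)) /=.
    rewrite (phis (ends e).2) addrA -mulr2n mulr_natl lerDl.
    by rewrite sumr_ge0.
  rewrite finset.setUC eqxx /=.
  by apply: contra (ends_neq e); case: (ends e) => a b /= /eqP[-> _].
rewrite (exchange_big_dep xpredT)//=; apply: ler_sum => p _.
have [e /eqP ee|none] := pickP (fun e : pairs V => [set p.1; p.2] == val e).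
  rewrite (big_pred1 e)// => e' /=.
  by rewrite ee; apply/eqP/eqP => [/val_inj|->].
by rewrite big_pred0.
Qed.

End Pairs.

(** An injective map pulls (s,q)-graphs back to (s,q)-graphs. *)
Lemma sq_graph_pullback (U V : finType) (s q : nat) (G : multigraph V)
    (psi : {ffun U -> V}) : injective psi -> is_sq_graph s q G ->
  is_sq_graph s q [ffun e : pairs U => mult G (psi (ends e).1) (psi (ends e).2)].
Proof.
move=> inj GF X cX.
have c2 (e : pairs U) : #|psi @: val e| == 2%N by rewrite card_imset// (valP e).
pose im (e : pairs U) : pairs V := Sub (psi @: val e) (c2 e).
have im_inj : injective im.
  by move=> e e' /(congr1 val) /= /(imset_inj inj) /val_inj.
apply: leq_trans (GF (psi @: X) _); last by rewrite card_imset.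
rewrite /weight_in -[leqRHS]/(\sum_(e' : pairs V | val e' \subset psi @: X) G e')%N.
pose A : {set pairs U} := [set e : pairs U | val e \subset X].
rewrite (bigID (fun e' => e' \in im @: A)) /=.
apply: leq_trans (leq_addr _ _).
rewrite [leqRHS](eq_bigl (fun e' => e' \in im @: A)); last first.
  move=> e' /=; rewrite andb_idl// => /imsetP[e]; rewrite inE => eX ->.
  exact: imsetS.
rewrite big_imset /=; last by move=> e e' _ _; exact: im_inj.
rewrite (eq_bigl (fun e => e \in A)) => [|e]; last by rewrite inE.
apply: leq_sum => e _; rewrite ffunE /mult.
have -> : [set psi (ends e).1; psi (ends e).2] = val (im e).
  by rewrite /= val_ends imsetU1 imset_set1.
by rewrite valK.
Qed.

Section Counting.
Local Open Scope ring_scope.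
Variables (R : realType) (U V : finType).
Hypothesis V0 : (0 < #|V|)%N.
Implicit Types (psi : {ffun U -> V}).

(** The map [psi] with its value at [i] replaced by [x]. *)
Definition upd psi i x : {ffun U -> V} := [ffun j => if j == i then x else psi j].

Lemma updE psi i x : upd psi i x i = x.
Proof. by rewrite ffunE eqxx. Qed.

Lemma upd_neq psi i j x : j != i -> upd psi i x j = psi j.
Proof. by move=> /negbTE ji; rewrite ffunE ji. Qed.

Lemma updC psi i j x y : i != j -> upd (upd psi i x) j y = upd (upd psi j y) i x.
Proof.
move=> ij; apply/ffunP => k; rewrite !ffunE.
by have [->|] := eqVneq k j => //; rewrite eq_sym (negbTE ij).
Qed.

Lemma sum_upd (Y : {ffun U -> V} -> R) i :
  \sum_psi \sum_x Y (upd psi i x) = #|V|%:R * \sum_psi Y psi.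
Proof.
pose sw (p : {ffun U -> V} * V) := (upd p.1 i p.2, p.1 i).
have swK : involutive sw.
  move=> [psi x]; rewrite /sw /= updE; congr (_, _).
  by apply/ffunP => j; rewrite !ffunE; case: eqP => [->|].
rewrite pair_big /= (eq_bigr (fun p => Y (sw p).1))//.
rewrite -(reindex_inj (inv_inj swK) (P := xpredT) (F := fun p => Y p.1)) /=.
rewrite -(pair_big xpredT xpredT (fun psi (_ : V) => Y psi)) /= mulr_sumr.
by apply: eq_bigr => psi _; rewrite sumr_const -[LHS]mulr_natl.
Qed.

Lemma sum_upd2 (Y : {ffun U -> V} -> R) i j :
  \sum_psi \sum_x \sum_y Y (upd (upd psi i x) j y) =
  #|V|%:R ^+ 2 * \sum_psi Y psi.
Proof.
rewrite (sum_upd (fun psi => \sum_y Y (upd psi j y)) i) sum_upd.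
by rewrite mulrA expr2.
Qed.

Lemma natV0 : (0 : R) < #|V|%:R.
Proof. by rewrite ltr0n. Qed.

Lemma sum_edge (phi : V -> V -> R) i j : i != j ->
  #|V|%:R ^+ 2 * (\sum_(psi : {ffun U -> V}) phi (psi i) (psi j)) =
  #|V|%:R ^+ #|U| * \sum_x \sum_y phi x y.
Proof.
move=> ij; rewrite -(sum_upd2 (fun psi => phi (psi i) (psi j)) i j).
rewrite (eq_bigr (fun=> \sum_x \sum_y phi x y)) => [|psi _].
  by rewrite sumr_const -[LHS]mulr_natl card_ffun natrX.
apply: eq_bigr => x _; apply: eq_bigr => y _.
by rewrite updE upd_neq// updE.
Qed.

Lemma card_noninjective :
  #|V|%:R * #|[set psi : {ffun U -> V} | ~~ injectiveb psi]|%:R <=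
  #|U|%:R ^+ 2 * #|V|%:R ^+ #|U| :> R.
Proof.
have -> : #|U|%:R ^+ 2 * #|V|%:R ^+ #|U| =
    \sum_(i : U) \sum_(j : U) #|V|%:R ^+ #|U| :> R.
  by rewrite 2!sumr_const -mulrnA -[RHS]mulr_natl natrM [X in X * _ = _]expr2.
apply: (@le_trans _ _ (\sum_i \sum_(j | j != i)
    #|V|%:R * \sum_(psi : {ffun U -> V}) (psi i == psi j)%:R)).
  under [leRHS]eq_bigr do rewrite -mulr_sumr.
  rewrite -mulr_sumr ler_wpM2l ?ler0n//.
  under [leRHS]eq_bigr do rewrite exchange_big.
  rewrite exchange_big /= -sum1_card natr_sum big_mkcond /=.
  apply: ler_sum => psi _; rewrite inE.
  have t0 (A : U -> pred U) : (0 : R) <= \sum_i \sum_(j | A i j) (psi i == psi j)%:R.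
    by do 2!apply: sumr_ge0 => ? _; rewrite ler0n.
  case: injectiveP => //= ninj.
  have [i [j [pij ij]]] : exists i j, psi i = psi j /\ i <> j.
    apply: contrapT => none; apply: ninj => i j pij.
    by apply: contrapT => ij; apply: none; exists i, j.
  rewrite (bigD1 i)//= (bigD1 j)/=; last by apply/eqP => ji; apply: ij.
  rewrite pij eqxx -addrA lerDl addr_ge0//.
    by apply: sumr_ge0 => ? _; rewrite ler0n.
  by do 2!apply: sumr_ge0 => ? _; rewrite ler0n.
apply: ler_sum => i _; rewrite big_mkcond; apply: ler_sum => j _ /=.
rewrite eq_sym; have [_|ij] := eqVneq i j; first by rewrite exprn_ge0.
rewrite -(sum_upd (fun psi => (psi i == psi j)%:R) j).
rewrite -natrX -card_ffun -sum1_card natr_sum; apply: ler_sum => psi _.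
rewrite (bigD1 (psi i))//= big1 ?addr0.
  by rewrite updE upd_neq// eqxx.
by move=> x xi; rewrite updE upd_neq// eq_sym (negbTE xi).
Qed.

(** A single pair [{i, j}]: once the values outside [i] and [j] are fixed, the
    remaining sum is a cut-norm test with the functions [u] and [u']. *)
Lemma edge_cut (D : V -> V -> R) (e : R) i j (u u' : {ffun U -> V} -> R) :
  i != j -> cut_le D e ->
  (forall psi, 0 <= u psi <= 1) -> (forall psi, 0 <= u' psi <= 1) ->
  (forall psi y, u (upd psi j y) = u psi) ->
  (forall psi x, u' (upd psi i x) = u' psi) ->
  `|\sum_(psi : {ffun U -> V}) u psi * u' psi * D (psi i) (psi j)| <= e * #|V|%:R ^+ #|U|.
Proof.
move=> ij De u01 u'01 uj u'i.
have n2 : (0 : R) < #|V|%:R ^+ 2 by rewrite exprn_gt0 ?natV0.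
rewrite -(ler_pM2l n2) -{1}(ger0_norm (ltW n2)) -normrM.
rewrite -(sum_upd2 (fun psi => u psi * u' psi * D (psi i) (psi j)) i j).
apply: le_trans (ler_norm_sum _ _ _) _.
have -> : #|V|%:R ^+ 2 * (e * #|V|%:R ^+ #|U|) =
    \sum_(psi : {ffun U -> V}) e * #|V|%:R ^+ 2.
  by rewrite sumr_const card_ffun -[RHS]mulr_natl natrX; ring.
apply: ler_sum => psi _.
rewrite (_ : \sum_x _ = \sum_x \sum_y u (upd psi i x) * u' (upd psi j y) * D x y).
  by apply: cut_le_fun.
apply: eq_bigr => x _; apply: eq_bigr => y _.
have ji : j != i by rewrite eq_sym.
by rewrite uj updC// u'i updE upd_neq// updE.
Qed.

(** The counting lemma: replacing the weight of every pair by a weight close in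
    the cut norm changes the number of weighted copies little. *)
Lemma counting_lemma (H H' : pairs U -> V -> V -> R) (e : R) :
  (forall k x y, 0 <= H k x y <= 1) -> (forall k x y, 0 <= H' k x y <= 1) ->
  (forall k, cut_le (fun x y => H k x y - H' k x y) e) ->
  `|\sum_(psi : {ffun U -> V}) \prod_k H k (psi (ends k).1) (psi (ends k).2) -
    \sum_(psi : {ffun U -> V}) \prod_k H' k (psi (ends k).1) (psi (ends k).2)|
  <= #|{: pairs U}|%:R * e * #|V|%:R ^+ #|U|.
Proof.
move=> H01 H'01 HH'.
(* Telescoping: the pairs are switched from [H] to [H'] one at a time. *)
pose mix (S : seq (pairs U)) k := if k \in S then H' k else H k.
pose T S : R := \sum_(psi : {ffun U -> V})
  \prod_k mix S k (psi (ends k).1) (psi (ends k).2).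
have mix01 S k x y : 0 <= mix S k x y <= 1 by rewrite /mix; case: ifP.
suff main (S : seq (pairs U)) : uniq S ->
    `|T [::] - T S| <= (size S)%:R * e * #|V|%:R ^+ #|U|.
  have := main _ (enum_uniq {: pairs U}); rewrite -cardE; congr (`|_ - _| <= _).
  apply: eq_bigr => psi _; apply: eq_bigr => k _.
  by rewrite /mix mem_enum.
elim: S => [|k0 S IH] /=; first by rewrite subrr normr0 !mul0r.
move=> /andP[kS /IH{}IH].
rewrite -natr1 2!mulrDl mul1r.
have -> : T [::] - T (k0 :: S) = (T [::] - T S) + (T S - T (k0 :: S)) by ring.
apply: le_trans (ler_normD _ _) _; apply: lerD => //.
(* No pair other than [k0] contains both of its ends, so the other factors
   split into those avoiding the second end and those avoiding the first. *)
pose P b psi := \prod_(k | (k != k0) && (((ends k0).2 \in val k) == b))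
  mix S k (psi (ends k).1) (psi (ends k).2).
have P01 b psi : 0 <= P b psi <= 1.
  rewrite prodr_ge0 /=; last by move=> k _; have /andP[] := mix01 S k (psi (ends k).1) (psi (ends k).2).
  by apply: Num.Theory.prodr_ile1 => k _; exact: mix01.
have -> : T S - T (k0 :: S) = \sum_(psi : {ffun U -> V}) P false psi * P true psi *
    (H k0 (psi (ends k0).1) (psi (ends k0).2) - H' k0 (psi (ends k0).1) (psi (ends k0).2)).
  rewrite /T -sumrB; apply: eq_bigr => psi _.
  rewrite (bigD1 k0)//= [X in _ - X](bigD1 k0)//= {1 3}/mix (negbTE kS) inE eqxx /=.
  rewrite (eq_bigr (fun k => mix S k (psi (ends k).1) (psi (ends k).2))
    (F1 := fun k => mix (k0 :: S) k _ _)) => [|k /negbTE kk]; last first.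
    by rewrite /mix inE kk.
  rewrite -mulrBl mulrC (bigID (fun k : pairs U => (ends k0).2 \in val k)) /=.
  rewrite [P false psi * _]mulrC; congr (_ * _ * _).
    by apply: eq_bigl => k; case: (_ \in val k).
  by apply: eq_bigl => k; case: (_ \in val k).
apply: (@edge_cut (fun x y => H k0 x y - H' k0 x y) e _ _ (P false) (P true)
  (ends_neq k0) (HH' k0)) => //.
- move=> psi y; apply: eq_bigr => k /andP[_ /eqP jk].
  rewrite !upd_neq//; apply/negP => /eqP je; move: jk.
    by rewrite -je ends2_in.
  by rewrite -je ends1_in.
- move=> psi x; apply: eq_bigr => k /andP[kk /eqP jk].
  have ik : (ends k0).1 \notin val k.
    apply: contra kk => ik; apply/eqP/esym; exact: ends_inj_in.
  rewrite !upd_neq//; apply/negP => /eqP ie; move: ik.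
    by rewrite -ie ends2_in.
  by rewrite -ie ends1_in.
Qed.

End Counting.

(** * The template of a multigraph *)

Section Template.
Local Open Scope ring_scope.
Variables (R : realType) (V : finType) (s q : nat) (G : multigraph V).
Variables (l : V -> nat) (eta e : R).
Hypotheses (V0 : (0 < #|V|)%N) (GF : is_sq_graph s q G)
  (Gq : forall k, (G k <= q)%N) (eta0 : 0 < eta) (eta1 : eta <= 1).

(** The indicator of multiplicity at least [v]. *)
Definition level (v : 'I_q.+1) (x y : V) : R := (v <= mult G x y)%N%:R.

(** The density of multiplicity at least [v] in the block of a pair. *)
Definition density (v : 'I_q.+1) : V -> V -> R := block_mean l (level v).

(** The largest multiplicity that is reached with density at least [eta] in the
    block of [(x, y)]; the density of multiplicity at least [0] is [1]. *)
Definition template (x y : V) : 'I_q.+1 :=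
  [arg max_(v > ord0 | (eta <= density v x y)%R) (v : nat)]%N.

Lemma level01 v x y : 0 <= level v x y <= 1.
Proof. by rewrite /level; case: (_ <= _)%N; rewrite /= ?lexx ler01. Qed.

Lemma density01 v x y : 0 <= density v x y <= 1.
Proof.
by rewrite block_mean_ge0 ?block_mean_le1// => a b; have /andP[] := level01 v a b.
Qed.

Lemma density0 x y : density ord0 x y = 1.
Proof.
have one (u : V -> R) z : (forall a, u a = 1) -> class_mean l u z = 1 :> R.
  move=> u1; rewrite /class_mean (eq_bigr (fun=> 1))// sumr_const divff//.
  by rewrite gt_eqF// class_card_gt0.
by rewrite /density /block_mean; apply: (one) => a; apply: (one) => b; rewrite /level leq0n.
Qed.

Lemma template_density x y : eta <= density (template x y) x y.
Proof.
by rewrite /template; case: arg_maxnP => //; rewrite density0.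
Qed.

Lemma template_max (v : 'I_q.+1) x y : eta <= density v x y -> (v <= template x y)%N.
Proof.
by move=> h; rewrite /template; case: arg_maxnP; rewrite ?density0// => i _; apply.
Qed.

Lemma template_block x x' y y' : l x = l x' -> l y = l y' ->
  template x y = template x' y'.
Proof.
move=> ex ey; have dE v : density v x y = density v x' y' by exact: block_meanS.
apply/val_inj/eqP; rewrite eqn_leq; apply/andP; split; apply: template_max.
  by rewrite -dE template_density.
by rewrite dE template_density.
Qed.

Lemma template_sym x y : template x y = template y x.
Proof.
have dE v : density v x y = density v y x.
  by apply: block_mean_sym => a b; rewrite /level mult_sym.
apply/val_inj/eqP; rewrite eqn_leq; apply/andP; split; apply: template_max.
  by rewrite -dE template_density.
by rewrite dE template_density.
Qed.

(** Multiplicities above the template occur only in blocks of low density. *)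
Lemma card_above_template :
  #|[set p : V * V | (template p.1 p.2 < mult G p.1 p.2)%N]|%:R
  <= q.+1%:R * eta * #|V|%:R ^+ 2 :> R.
Proof.
pose chi v x y : R := (density v x y < eta)%R%:R.
apply: (@le_trans _ _ (\sum_(v : 'I_q.+1) \sum_x \sum_y chi v x y * level v x y)).
  rewrite exchange_big /=; under [leRHS]eq_bigr do rewrite exchange_big.
  rewrite pair_big /= -sum1_card natr_sum big_mkcond; apply: ler_sum => p _.
  have t0 (P : pred 'I_q.+1) : 0 <= \sum_(v | P v) chi v p.1 p.2 * level v p.1 p.2.
    by apply: sumr_ge0 => v _; rewrite mulr_ge0 ?ler0n.
  rewrite inE; case: ifP => // lt_tg.
  have tq : ((template p.1 p.2).+1 < q.+1)%N.
    exact: leq_trans lt_tg (mult_le _ _ Gq).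
  rewrite (bigD1 (Ordinal tq))//= /level /= lt_tg mulr1 /chi.
  case: ltP => [_|/template_max]; first by rewrite lerDl.
  by rewrite /= ltnn.
apply: (@le_trans _ _ (\sum_(v : 'I_q.+1) \sum_(x : V) \sum_(y : V) eta)).
  apply: ler_sum => v _; rewrite -(@block_mean_proj _ _ l); last first.
    by move=> x x' y y' ex ey; rewrite /chi /density (block_meanS _ ex ey).
  apply: ler_sum => x _; apply: ler_sum => y _; rewrite /chi -/(density v x y).
  by case: ltP => [/ltW|_]; rewrite ?mul1r// mul0r ltW.
by rewrite 3!sumr_const card_ord -2!mulrnA -[X in X <= _]mulr_natl !natrM; nra.
Qed.

Hypothesis reg : forall v, cut_le (fun x y => level v x y - density v x y) e.

Section Maps.
Variable U : finType.
Implicit Types (psi : {ffun U -> V}).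

(** The multigraph with bounded multiplicities [a]. *)
Definition to_mg (a : {ffun pairs U -> 'I_q.+1}) : multigraph U := [ffun k => a k : nat].

(** The pattern that [psi] finds in the template. *)
Definition template_pullback psi : {ffun pairs U -> 'I_q.+1} :=
  [ffun k => template (psi (ends k).1) (psi (ends k).2)].

(** A pattern that is not an (s,q)-graph is hardly ever found in the template:
    otherwise a copy of it would lie below [G] itself. *)
Lemma pattern_rare (a : {ffun pairs U -> 'I_q.+1}) : ~ is_sq_graph s q (to_mg a) ->
  eta ^+ #|{: pairs U}| * #|[set psi | template_pullback psi == a]|%:R <=
  (#|U|%:R ^+ 2 / #|V|%:R + #|{: pairs U}|%:R * e) * #|V|%:R ^+ #|U|.
Proof.
move=> naF.
pose T (f : 'I_q.+1 -> V -> V -> R) : R := \sum_(psi : {ffun U -> V})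
  \prod_k f (a k) (psi (ends k).1) (psi (ends k).2).
have TE : `|T level - T density| <= #|{: pairs U}|%:R * e * #|V|%:R ^+ #|U|.
  apply: (@counting_lemma _ _ _ V0 (fun k => level (a k)) (fun k => density (a k))).
  - by move=> k x y; exact: level01.
  - by move=> k x y; exact: density01.
  - by move=> k; exact: reg.
have Tl : T level <= #|[set psi : {ffun U -> V} | ~~ injectiveb psi]|%:R.
  rewrite -sum1_card natr_sum [leRHS]big_mkcond; apply: ler_sum => psi _.
  rewrite inE; case: ifP => [_|/negbFE/injectiveP inj].
    by apply: Num.Theory.prodr_ile1 => k _; exact: level01.
  have [/forallP all_le|] := boolP [forall k, a k <= mult G (psi (ends k).1) (psi (ends k).2)]%N.
    case: naF => X cX; apply: leq_trans (sq_graph_pullback inj GF cX).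
    by apply: leq_sum => k _; rewrite !ffunE.
  rewrite negb_forall => /existsP[k /negbTE nk].
  by rewrite (bigD1 k)//= /level nk mul0r.
have Td : eta ^+ #|{: pairs U}| * #|[set psi | template_pullback psi == a]|%:R <= T density.
  rewrite -sum1_card natr_sum mulr_sumr big_mkcond; apply: ler_sum => psi _.
  have p0 : 0 <= \prod_k density (a k) (psi (ends k).1) (psi (ends k).2).
    by apply: prodr_ge0 => k _; have /andP[] := density01 (a k) (psi (ends k).1) (psi (ends k).2).
  rewrite inE; case: eqP => // /ffunP pa; rewrite mulr1.
  have -> : eta ^+ #|{: pairs U}| = \prod_(k : pairs U) eta by rewrite prodr_const.
  by apply: ler_prod => k _; rewrite ltW//= -pa ffunE template_density.
have ninj : #|[set psi : {ffun U -> V} | ~~ injectiveb psi]|%:R <=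
    #|U|%:R ^+ 2 / #|V|%:R * #|V|%:R ^+ #|U| :> R.
  by rewrite mulrAC ler_pdivlMr ?natV0// mulrC card_noninjective.
apply: le_trans Td _; rewrite mulrDl; move: TE (le_trans Tl ninj).
rewrite ler_norml => /andP[+ _].
move: (T level) (T density) (_ / _ * _) (_ * _ * _) => t t' A B ? ?; lra.
Qed.

(** The maps that do not pull the template back to an (s,q)-graph. *)
Definition atypical : {set {ffun U -> V}} :=
  [set psi | ~~ `[< is_sq_graph s q (to_mg (template_pullback psi)) >]].

Lemma card_atypical :
  eta ^+ #|{: pairs U}| * #|atypical|%:R <= q.+1%:R ^+ #|{: pairs U}| *
  ((#|U|%:R ^+ 2 / #|V|%:R + #|{: pairs U}|%:R * e) * #|V|%:R ^+ #|U|).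
Proof.
set c := (X in _ <= _ * X).
have c0 : 0 <= c.
  have e0 : 0 <= e * #|V|%:R ^+ 2.
    by apply: le_trans (reg ord0 finset.set0 finset.set0); exact: normr_ge0.
  rewrite /c mulr_ge0// addr_ge0 ?divr_ge0 ?mulr_ge0//.
  by move: e0; rewrite pmulr_lge0// exprn_gt0 ?natV0.
have -> : q.+1%:R ^+ #|{: pairs U}| * c = \sum_(a : {ffun pairs U -> 'I_q.+1}) c.
  by rewrite sumr_const card_ffun card_ord -[RHS]mulr_natl natrX.
rewrite -sum1_card (partition_big template_pullback xpredT)//= natr_sum mulr_sumr.
apply: ler_sum => a _.
have [aF|/asboolPn naF] := boolP `[< is_sq_graph s q (to_mg a) >].
  rewrite big_pred0 ?mulr0// => psi; rewrite inE.
  by apply/negP => /andP[+ /eqP pa]; rewrite pa aF.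
apply: le_trans (pattern_rare naF); rewrite ler_pM2l ?exprn_gt0// ler_nat sum1_card.
by apply/subset_leq_card/fintype.subsetP => psi; rewrite !inE => /andP[].
Qed.

(** The template has small weight, by averaging over all maps [U -> V]. *)
Lemma template_weight (L mu : R) : (0 < #|{: pairs U}|)%N -> 0 <= L ->
  (forall H : multigraph U, is_sq_graph s q H ->
     \sum_k ln ((H k).+1%:R) <= #|{: pairs U}|%:R * L) ->
  #|atypical|%:R <= mu * #|V|%:R ^+ #|U| ->
  \sum_x \sum_y ln ((template x y).+1%:R) <=
    #|V|%:R ^+ 2 * (L + mu * ln q.+1%:R).
Proof.
set M : R := #|{: pairs U}|%:R => M0 L0 HL bad.
have {M0}M0 : 0 < M by rewrite ltr0n.
have lnq (v : 'I_q.+1) : ln (v.+1%:R) <= ln (q.+1%:R) :> R.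
  by rewrite ler_ln ?posrE ?ltr0n// ler_nat ltn_ord.
have lnq0 : 0 <= ln (q.+1%:R) :> R by rewrite ln_ge0// ler1n.
pose phi x y : R := ln ((template x y).+1%:R).
have S1 : #|V|%:R ^+ 2 * (\sum_(psi : {ffun U -> V})
    \sum_(k : pairs U) phi (psi (ends k).1) (psi (ends k).2)) =
    M * (#|V|%:R ^+ #|U| * \sum_x \sum_y phi x y).
  rewrite exchange_big mulr_sumr /= (eq_bigr (fun=> #|V|%:R ^+ #|U| *
    \sum_x \sum_y phi x y)) => [|k _]; last exact: sum_edge (ends_neq k).
  by rewrite sumr_const -[LHS]mulr_natl.
have S2 : \sum_(psi : {ffun U -> V})
    \sum_(k : pairs U) phi (psi (ends k).1) (psi (ends k).2) <=
    #|V|%:R ^+ #|U| * (M * L) + #|atypical|%:R * (M * ln q.+1%:R).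
  have -> : #|V|%:R ^+ #|U| * (M * L) = \sum_(psi : {ffun U -> V}) M * L.
    by rewrite sumr_const card_ffun -[RHS]mulr_natl natrX.
  have -> : #|atypical|%:R * (M * ln q.+1%:R) =
      \sum_(psi : {ffun U -> V}) if psi \in atypical then M * ln q.+1%:R else 0.
    by rewrite -big_mkcond sumr_const -[RHS]mulr_natl.
  rewrite -big_split; apply: ler_sum => psi _ /=.
  rewrite inE; case: asboolP => /= [psiF|_].
    rewrite addr0; apply: le_trans (HL _ psiF).
    by apply: ler_sum => k _; rewrite !ffunE.
  apply: (@le_trans _ _ (M * ln q.+1%:R)); last by rewrite lerDr mulr_ge0// ltW.
  rewrite /M mulr_natl -sumr_const; apply: ler_sum => k _; exact: lnq.
have n0 : 0 < #|V|%:R ^+ #|U| :> R by rewrite exprn_gt0 ?natV0.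
have n2 : 0 < #|V|%:R ^+ 2 :> R by rewrite exprn_gt0 ?natV0.
rewrite -(ler_pM2l n0) -(ler_pM2l M0) -S1.
have -> : M * (#|V|%:R ^+ #|U| * (#|V|%:R ^+ 2 * (L + mu * ln q.+1%:R))) =
  #|V|%:R ^+ 2 * (#|V|%:R ^+ #|U| * (M * L) + (mu * #|V|%:R ^+ #|U|) * (M * ln q.+1%:R)).
  ring.
rewrite ler_pM2l//; apply: le_trans S2 _; rewrite lerD2l ler_wpM2r//.
by rewrite mulr_ge0// ltW.
Qed.

End Maps.
End Template.

(** * Containers *)

Section SparseChanges.
Local Open Scope ring_scope.
Variables (R : realType) (I : finType) (q : nat).

(** The partial functions on [I] whose domain has at most [x] elements. *)
Definition sparse (x : R) : {set {ffun I -> option 'I_q.+1}} :=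
  [set Z : {ffun I -> option 'I_q.+1} | #|[set k | Z k]|%:R <= x].

(** There are few ways to prescribe new values on a small set of coordinates. *)
Lemma card_sparse (lam x : R) : 0 <= lam ->
  #|sparse x|%:R <= expR (lam * x + q.+1%:R * expR (- lam) * #|I|%:R).
Proof.
move=> lam0.
(* Each prescribed coordinate gets weight [expR (- lam)], and the total weight
   of all partial functions is a product over the coordinates. *)
pose c (o : option 'I_q.+1) : R := if o then expR (- lam) else 1.
have cE (Z : {ffun I -> option 'I_q.+1}) :
    \prod_k c (Z k) = expR (- lam * #|[set k | Z k]|%:R).
  rewrite mulrC expRM_natl -prodr_const [RHS]big_mkcond /=.
  by apply: eq_bigr => k _; rewrite inE.
have sumc : \sum_o c o = 1 + q.+1%:R * expR (- lam).
  rewrite (bigD1 None)//=; congr (_ + _).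
  rewrite (reindex_omap (@Some 'I_q.+1) id) => [|[]//] /=.
  rewrite (eq_bigl xpredT) => [|i]; last by rewrite eqxx.
  by rewrite sumr_const card_ord -[LHS]mulr_natl.
rewrite expRD mulrC -ler_pdivrMr ?expR_gt0// -expRN mulrC.
apply: (@le_trans _ _ (\sum_(Z : {ffun I -> option 'I_q.+1}) \prod_k c (Z k))).
  rewrite -sum1_card natr_sum mulr_sumr big_mkcond; apply: ler_sum => Z _.
  rewrite cE inE; case: ifP => Zx; last exact: expR_ge0.
  by rewrite mulr1 ler_expR -mulNr ler_wnM2l// oppr_le0.
rewrite -(bigA_distr_bigA (fun _ => c)) /= prodr_const sumc.
rewrite expRM_natr lerXn2r ?nnegrE ?expR_ge0 ?addr_ge0 ?mulr_ge0 ?expR_ge0//.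
exact: expR_ge1Dx.
Qed.

Lemma ln_boxsize (C : {ffun I -> 'I_q.+1}) :
  ln (boxsize C)%:R = \sum_k ln (C k).+1%:R :> R.
Proof.
rewrite /boxsize natr_prod.
suff [] : 0 < \prod_k (C k).+1%:R :> R /\
  ln (\prod_k (C k).+1%:R) = \sum_k ln (C k).+1%:R :> R by [].
apply: (big_ind2 (fun x y : R => 0 < x /\ ln x = y)); first by rewrite ln1.
- by move=> x1 x2 y1 y2 [x0 <-] [y0 <-]; rewrite mulr_gt0// lnM ?posrE.
- by move=> k _; rewrite ltr0n.
Qed.

End SparseChanges.

Lemma card_pairs_le (V : finType) : (#|{: pairs V}| <= #|V| ^ 2)%N.
Proof.
rewrite -mulnn -card_prod -(card_codom (f := @ends V)) ?max_card// => e e' ee.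
by apply: ends_inj_in; rewrite ee ?ends1_in ?ends2_in.
Qed.

Section Containers.
Local Open Scope ring_scope.
Variables (R : realType) (V : finType) (s q K : nat).
Hypothesis V0 : (0 < #|V|)%N.

(** The multigraph with value [Z k] where this is specified, and a value that
    depends only on the labels of the two ends elsewhere. *)
Definition labelled_box (c : {ffun V -> 'I_K} * {ffun 'I_K * 'I_K -> 'I_q.+1} *
    {ffun pairs V -> option 'I_q.+1}) : {ffun pairs V -> 'I_q.+1} :=
  [ffun k => odflt (c.1.2 (c.1.1 (ends k).1, c.1.1 (ends k).2)) (c.2 k)].

(** The containers: labelled boxes with at most [theta * #|V| ^ 2] explicitly
    specified values whose logarithmic size is at most [b * #|V| ^ 2]. *)
Definition containers (theta b : R) : {set {ffun pairs V -> 'I_q.+1}} :=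
  [set C in labelled_box @: finset.setX [set: _] (sparse _ q (theta * #|V|%:R ^+ 2))
  | ln (boxsize C)%:R <= b * #|V|%:R ^+ 2].

Lemma card_containers (theta b lam : R) : (0 < K)%N -> 0 <= lam ->
  #|containers theta b|%:R <= expR (#|V|%:R * ln K%:R + (K ^ 2)%:R * ln q.+1%:R +
    (lam * theta + q.+1%:R * expR (- lam)) * #|V|%:R ^+ 2).
Proof.
move=> K0 lam0.
have le1 : (#|containers theta b| <= K ^ #|V| * q.+1 ^ (K ^ 2) *
    #|sparse (pairs V) q (theta * #|V|%:R ^+ 2)%R|)%N.
  set A := finset.setX [set: {ffun V -> 'I_K} * {ffun 'I_K * 'I_K -> 'I_q.+1}]
    (sparse (pairs V) q (theta * #|V|%:R ^+ 2)%R).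
  apply: (@leq_trans #|labelled_box @: A|).
    by apply/subset_leq_card/fintype.subsetP => C; rewrite inE => /andP[].
  apply: leq_trans (leq_imset_card labelled_box A) _.
  by rewrite cardsX finset.cardsT card_prod !card_ffun card_prod !card_ord mulnn.
have pw (a j : nat) : (0 < a)%N -> (a ^ j)%:R = expR (j%:R * ln a%:R) :> R.
  by move=> a0; rewrite natrX expRM_natl lnK// posrE ltr0n.
rewrite -(ler_nat R) in le1; apply: le_trans le1 _.
rewrite 2!natrM (pw K #|V|)// (pw q.+1)// -expRD [leRHS]expRD ler_pM2l ?expR_gt0//.
apply: le_trans (card_sparse _ _ _ lam0) _; rewrite ler_expR mulrDl mulrA lerD2l.
by rewrite ler_wpM2l ?mulr_ge0 ?expR_ge0// -natrX ler_nat card_pairs_le.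
Qed.

(** If the partition into the fibres of [l] is cut-norm regular for [G] with a
    small enough error [e], then the template of [G], corrected on the pairs
    where [G] exceeds it, is a container of [G]. *)
Lemma in_containers (theta L gam mu eta e : R) (l : V -> nat) (U : finType)
    (G : {ffun pairs V -> 'I_q.+1}) :
  (forall x, (l x < K)%N) -> is_sq_graph s q (to_mg G) ->
  0 < eta -> eta <= 1 -> q.+1%:R * eta <= theta ->
  (forall v : 'I_q.+1, cut_le (fun x y => level R (to_mg G) v x y - density R (to_mg G) l v x y) e) ->
  (0 < #|{: pairs U}|)%N -> 0 <= L ->
  (forall H : multigraph U, is_sq_graph s q H ->
     \sum_k ln ((H k).+1%:R) <= #|{: pairs U}|%:R * L) ->
  q.+1%:R ^+ #|{: pairs U}| *
    (#|U|%:R ^+ 2 / #|V|%:R + #|{: pairs U}|%:R * e) <= eta ^+ #|{: pairs U}| * mu ->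
  L / 2 + mu * ln q.+1%:R / 2 + theta * ln q.+1%:R <= gam ->
  exists2 C, C \in containers theta gam & below G C.
Proof.
have arith (L' gam' mu' th lq n a z : R) : 2 * a <= n * (L' + mu' * lq) ->
  z <= th * n * lq -> (L' / 2 + mu' * lq / 2 + th * lq) * n <= gam' * n ->
  a + z <= gam' * n by move=> ? ? ?; lra.
move=> lK GF eta0 eta1 etath reg U0 L0 HL small le_gam.
have Gq (k : pairs V) : (to_mg G k <= q)%N by rewrite ffunE -ltnS.
pose w := template q (to_mg G) l eta.
pose l' : {ffun V -> 'I_K} := [ffun x => Ordinal (lK x)].
pose tau : {ffun 'I_K * 'I_K -> 'I_q.+1} := [ffun ab : 'I_K * 'I_K =>
  if [pick p : V * V | (l' p.1 == ab.1) && (l' p.2 == ab.2)] is Some p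
  then w p.1 p.2 else ord0].
have tauE x y : tau (l' x, l' y) = w x y.
  rewrite ffunE; case: pickP => [p /= /andP[/eqP ex /eqP ey]|/(_ (x, y))]; last first.
    by rewrite !eqxx.
  move: ex ey; rewrite !ffunE => -[ex] [ey].
  exact: template_block.
pose Z : {ffun pairs V -> option 'I_q.+1} := [ffun k =>
  if (w (ends k).1 (ends k).2 < G k)%N then Some (G k) else None].
have supp : #|[set k | Z k]|%:R <= theta * #|V|%:R ^+ 2.
  have := card_above_template l Gq eta0 eta1.
  move=> /(le_trans _) h; apply: le_trans (h _ _) _; last first.
    by rewrite ler_wpM2r ?exprn_ge0.
  rewrite ler_nat -(card_imset (f := @ends V)); last first.
    by move=> k k' kk; apply: ends_inj_in; rewrite kk ?ends1_in ?ends2_in.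
  apply/subset_leq_card/fintype.subsetP => _ /imsetP[k kZ ->].
  move: kZ; rewrite !inE ffunE mult_ends ffunE.
  by rewrite -/w; case: ifP.
pose C := labelled_box (l', tau, Z).
have CE k : C k = if (w (ends k).1 (ends k).2 < G k)%N then G k else w (ends k).1 (ends k).2.
  by rewrite ffunE /= tauE [Z k]ffunE; case: ifP.
exists C; last first.
  apply/belowP => k; rewrite CE; case: ltnP => //.
rewrite inE; apply/andP; split.
  by apply/imsetP; exists (l', tau, Z) => //; rewrite !inE /=.
have lnq0 : 0 <= ln q.+1%:R :> R by rewrite ln_ge0// ler1n.
have lnn (j : nat) : 0 <= ln j.+1%:R :> R by rewrite ln_ge0// ler1n.
rewrite ln_boxsize.
apply: (@le_trans _ _ (\sum_k ln (w (ends k).1 (ends k).2).+1%:R +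
    #|[set k | Z k]|%:R * ln q.+1%:R)).
  have -> : #|[set k | Z k]|%:R * ln q.+1%:R =
      \sum_k (if k \in [set k | Z k] then ln q.+1%:R else 0) :> R.
    by rewrite -big_mkcond sumr_const -[RHS]mulr_natl.
  rewrite -big_split; apply: ler_sum => k _ /=.
  rewrite CE inE ffunE; case: ifP => //= wG; last by rewrite addr0.
  apply: (@le_trans _ _ (ln q.+1%:R)); last by rewrite lerDr.
  by rewrite ler_ln ?posrE ?ltr0n// ler_nat ltn_ord.
have W := @template_weight R V s q (to_mg G) l eta V0 U L mu U0 L0 HL.
have atyp : #|@atypical R V s q (to_mg G) l eta U|%:R <= mu * #|V|%:R ^+ #|U|.
  have etaM : 0 < eta ^+ #|{: pairs U}| by rewrite exprn_gt0.
  rewrite -(ler_pM2l etaM); apply: le_trans (card_atypical V0 GF eta0 eta1 reg U) _.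
  by rewrite !mulrA ler_wpM2r ?exprn_ge0//; rewrite -mulrA.
have {W atyp} W := W atyp.
have P := @sum_pairs_le V R (fun x y => ln (w x y).+1%:R) (fun x y => lnn (w x y)) _.
have {P} P := P (fun x y => congr1 (fun v : 'I_q.+1 => ln v.+1%:R : R)
  (template_sym q (to_mg G) l eta1 x y)).
have {W} P := le_trans P W.
have S : #|[set k | Z k]|%:R * ln q.+1%:R <= theta * #|V|%:R ^+ 2 * ln q.+1%:R.
  by rewrite ler_wpM2r.
have n2 : 0 <= #|V|%:R ^+ 2 :> R by rewrite exprn_ge0.
exact: arith P S (ler_wpM2r n2 le_gam).
Qed.

End Containers.

Section ContainerTheorem.
Local Open Scope ring_scope.

(** Every (s,q)-graph on [V] lies below one of few containers, none of which
    has an essentially larger box than the (s,q)-graphs on a fixed number [m]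
    of vertices suggest. *)
Lemma container_theorem (R : realType) (s q m : nat) (L gam : R) :
  0 < gam -> 0 <= L -> (0 < #|{: pairs 'I_m}|)%N ->
  (forall H : multigraph 'I_m, is_sq_graph s q H ->
     \sum_k ln ((H k).+1%:R) <= #|{: pairs 'I_m}|%:R * L) ->
  exists n0 : nat, forall V : finType, (n0 <= #|V|)%N ->
  exists CC : {set {ffun pairs V -> 'I_q.+1}},
    [/\ #|CC|%:R <= expR (gam * #|V|%:R ^+ 2),
        forall C, C \in CC -> ln (boxsize C)%:R <= (L / 2 + gam) * #|V|%:R ^+ 2 &
        forall G : {ffun pairs V -> 'I_q.+1}, is_sq_graph s q (to_mg G) ->
          exists2 C, C \in CC & below G C].
Proof.
move=> gam0 L0 U0 HL.
set M := #|{: pairs 'I_m}|; pose q1 : R := q.+1%:R; pose lnq := ln q1.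
have M0 : 0 < M%:R :> R by rewrite ltr0n.
have q10 : 0 < q1 by rewrite ltr0n.
have lnq0 : 0 <= lnq by rewrite ln_ge0// ler1n.
(* [t] is the weight [expR (- lam)] of a correction, [theta] the proportion of
   corrected pairs, [mu] the proportion of atypical maps, [eta] the density
   threshold, [e] the regularity error and [K] the number of classes. *)
pose t : R := Num.min 1 (gam / (4 * q1)).
have t0 : 0 < t by rewrite lt_min ltr01 divr_gt0// mulr_gt0.
pose lam := - ln t.
have lam0 : 0 <= lam by rewrite oppr_ge0 ln_le0// ge_min lexx.
have qt : q1 * expR (- lam) <= gam / 4.
  rewrite opprK lnK ?posrE// mulrC -ler_pdivlMr// -mulrA -invfM.
  by rewrite ge_min lexx orbT.
pose theta := gam / (4 * (1 + lam + lnq)).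
have s0 : 0 < 1 + lam + lnq by rewrite -addrA ltr_pwDl// addr_ge0.
have theta0 : 0 < theta by rewrite divr_gt0// mulr_gt0.
have thetaE : theta * (1 + lam + lnq) = gam / 4.
  by rewrite /theta invfM mulrA mulfVK// gt_eqF.
(* Below, [clear -lam] hides from [lra] all but the facts in the goal. *)
have thl : lam * theta <= gam / 4.
  by rewrite -thetaE mulrC ler_pM2l//; move: lnq0; clear -lam; lra.
have thq : theta * lnq <= gam / 4.
  by rewrite -thetaE ler_pM2l//; move: lam0; clear -lam; lra.
pose mu := gam / (1 + lnq).
have lnq1 : 0 < 1 + lnq by rewrite ltr_pwDl.
have mu0 : 0 < mu by rewrite divr_gt0.
have muq : mu * lnq <= gam.
  rewrite /mu mulrAC ler_pdivrMr// ler_pM2l//; by rewrite lerDr.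
pose eta : R := Num.min 1 (theta / q1).
have eta0 : 0 < eta by rewrite lt_min ltr01 divr_gt0.
have eta1 : eta <= 1 by rewrite ge_min lexx.
have etath : q1 * eta <= theta by rewrite mulrC -ler_pdivlMr// ge_min lexx orbT.
pose qM := q1 ^+ M; pose eM := eta ^+ M * mu.
have qM0 : 0 < qM by rewrite exprn_gt0.
have eM0 : 0 < eM by rewrite mulr_gt0// exprn_gt0.
pose e := eM / (2 * qM * M%:R).
have e0 : 0 < e by rewrite divr_gt0// !mulr_gt0.
pose k := (Num.truncn (q1 / e ^+ 2)).+1.
have kP : #|'I_q.+1|%:R < k%:R * e ^+ 2.
  by rewrite card_ord -ltr_pdivrMr ?exprn_gt0// truncnS_gt.
pose K := (4 ^ k)%N.
have K0 : (0 < K)%N by rewrite expn_gt0.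
have lnK0 : 0 <= ln K%:R :> R by rewrite ln_ge0// ler1n.
pose c1 := 2 * (qM * m%:R ^+ 2) / eM.
pose c2 := 2 * (ln K%:R + (K ^ 2)%:R * lnq) / gam.
exists ((Num.truncn c1).+1 + (Num.truncn c2).+1)%N => V nV.
have V0 : (0 < #|V|)%N by apply: leq_trans nV.
set n : R := #|V|%:R.
have n0 : 0 < n by rewrite ltr0n.
have n1 : 1 <= n by rewrite ler1n.
have c1n : c1 <= n.
  by apply/ltW/(lt_le_trans (truncnS_gt _)); rewrite ler_nat (leq_trans _ nV)// leq_addr.
have c2n : c2 <= n.
  by apply/ltW/(lt_le_trans (truncnS_gt _)); rewrite ler_nat (leq_trans _ nV)// leq_addl.
have n2 : n ^+ 2 = n * n by rewrite expr2.
exists (containers V q K theta (L / 2 + gam)); split.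
- apply: le_trans (card_containers V q theta (L / 2 + gam) K0 lam0) _.
  rewrite ler_expR -/n -/q1 -/lnq.
  have h1 : (lam * theta + q1 * expR (- lam)) * n ^+ 2 <= gam / 2 * n ^+ 2.
    by rewrite ler_wpM2r ?exprn_ge0 ?(ltW n0)//; move: thl qt; clear -lam; lra.
  have h2 : n * ln K%:R + (K ^ 2)%:R * lnq <= gam / 2 * n ^+ 2.
    have h3 : 2 * (ln K%:R + (K ^ 2)%:R * lnq) <= n * gam.
      by rewrite -ler_pdivrMr.
    have h4 : (K ^ 2)%:R * lnq <= n * ((K ^ 2)%:R * lnq).
      by rewrite ler_peMl// mulr_ge0.
    have h5 := ler_wpM2l (ltW n0) h3.
    move: h4 h5; rewrite n2; move: (ln K%:R) ((K ^ 2)%:R * lnq) => a b.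
    clear -lam; lra.
  move: h1 h2; clear -lam; lra.
- by move=> C; rewrite inE => /andP[].
move=> G GF.
have h01 v x y : 0 <= level R (to_mg G) (v : 'I_q.+1) x y <= 1 by exact: level01.
have [l lK reg] := weak_regularity h01 e0 kP.
have le_gam : L / 2 + mu * lnq / 2 + theta * lnq <= L / 2 + gam.
  by move: muq thq gam0; clear -lam; lra.
suff small : qM * (#|'I_m|%:R ^+ 2 / n + M%:R * e) <= eM.
  exact: (in_containers V0 lK GF eta0 eta1 etath reg U0 L0 HL small le_gam).
rewrite card_ord mulrDr.
have -> : qM * (M%:R * e) = eM / 2.
  rewrite /e; move: (lt0r_neq0 qM0) (lt0r_neq0 M0); clear -lam => qM0 M0.
  by field; rewrite qM0 M0.
have : qM * (m%:R ^+ 2 / n) <= eM / 2.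
  rewrite mulrA ler_pdivrMr//; move: c1n; rewrite /c1 ler_pdivrMr//.
  move: (m%:R ^+ 2) => m2; clear -lam; lra.
clear -lam; lra.
Qed.

End ContainerTheorem.

(** * Counting (s,q)-graphs *)

Section SqGraphs.
Local Open Scope nat_scope.

Lemma card_pairs_in (V : finType) (X : {set V}) :
  #|[set e : pairs V | val e \subset X]| = 'C(#|X|, 2).
Proof.
rewrite -cards_draws -(card_imset _ (@val_inj _ _ (pairs V))).
apply: eq_card => A; rewrite inE; apply/imsetP/andP => [[e]|[AX cA]].
  by rewrite inE => eX ->; rewrite eX (valP e).
by exists (Sub A cA) => //; rewrite inE.
Qed.

Lemma card_pairs (n : nat) : #|{: pairs 'I_n}| = 'C(n, 2).
Proof.
rewrite -[in RHS](card_ord n) -[in RHS]finset.cardsT -card_pairs_in.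
by apply: eq_card => e; rewrite !inE finset.subsetT.
Qed.

Lemma mg_plus_sq_graph (V : finType) (s q : nat) (G : multigraph V) :
  is_sq_graph s q G -> is_sq_graph s (q + 'C(s, 2)) (mg_plus G).
Proof.
move=> GF X cX; rewrite -cX -card_pairs_in /weight_in.
rewrite (eq_bigr (fun e => G e + 1)) => [|e _]; last by rewrite ffunE addn1.
rewrite big_split /= leq_add ?GF// sum1_card; apply: eq_leq.
by apply: eq_card => e; rewrite !inE.
Qed.

Lemma sq_graph_le (V : finType) (s q : nat) (G : multigraph V) : 2 <= s <= #|V| ->
  is_sq_graph s q G -> forall e, G e <= q.
Proof.
move=> /andP[s2 sV] GF e.
have [|X eX cX] := @superset_card _ (val e) s _ sV; first by rewrite (eqP (valP e)).
by apply: leq_trans (GF X cX); rewrite /weight_in (bigD1 e)//= leq_addr.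
Qed.

(** Multigraphs with multiplicities at most [q] as members of a finite type. *)
Definition sq_set (V : finType) (s q : nat) : {set {ffun pairs V -> 'I_q.+1}} :=
  [set G | `[< is_sq_graph s q (to_mg G) >]].

Lemma sq_setP (V : finType) (s q : nat) (G : {ffun pairs V -> 'I_q.+1}) :
  reflect (is_sq_graph s q (to_mg G)) (G \in sq_set V s q).
Proof. by rewrite inE; exact: asboolP. Qed.

(** Being an (s,q)-graph is violated on the pairs inside a single s-set. *)
Lemma sq_set_local (V : finType) (s q : nat) (C : {ffun pairs V -> 'I_q.+1}) :
  C \notin sq_set V s q -> exists2 S : {set pairs V}, #|S| <= 'C(s, 2) &
    forall G, agree S G C -> G \notin sq_set V s q.
Proof.
move=> /sq_setP/existsNP[X /not_implyP[cX big]].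
exists [set e : pairs V | val e \subset X]; first by rewrite card_pairs_in cX.
move=> G /agreeP ag; apply/sq_setP => /(_ X cX) GX; apply: big.
apply: leq_trans GX; apply: eq_leq; apply: eq_bigr => e eX.
by rewrite !ffunE ag// inE.
Qed.

Lemma to_mg_inj (V : finType) (q : nat) : injective (@to_mg q V).
Proof.
move=> G G' /ffunP e; apply/ffunP => k; apply/val_inj.
by have := e k; rewrite !ffunE.
Qed.

Lemma card_set_sq (n s q : nat) (A : set (multigraph 'I_n)) : 2 <= s <= n ->
  (A `<=` sq_graphs n s q)%classic ->
  card_set A = #|[set G : {ffun pairs 'I_n -> 'I_q.+1} | `[< A (to_mg G) >]]|.
Proof.
move=> sn AF; have fin := sub_finite_set AF (finite_sq_graphs q sn).
set S := [set G | _].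
have SE G : (G \in S) = `[< A (to_mg G) >] by rewrite /S finset.in_set.
rewrite /card_set cardE -(size_map (@to_mg q 'I_n)).
apply/perm_size/uniq_perm; first exact: fset_uniq.
  by rewrite map_inj_uniq ?enum_uniq//; exact: to_mg_inj.
move=> G; rewrite in_fset_set//; apply/idP/mapP => [|[G']]; last first.
  by rewrite mem_enum SE => /asboolP AG ->; exact: mem_set.
move=> /set_mem AG.
have Gq : forall e, G e <= q by apply: (sq_graph_le _ (AF _ AG)); rewrite card_ord.
have GE : G = to_mg [ffun e => inord (G e) : 'I_q.+1].
  by apply/ffunP => e; rewrite !ffunE inordK ?ltnS.
exists [ffun e => inord (G e) : 'I_q.+1] => //.
by rewrite mem_enum SE; apply/asboolP; rewrite -GE.
Qed.

Lemma mg_prod_plus (V : finType) (q : nat) (G : {ffun pairs V -> 'I_q.+1}) :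
  mg_prod (mg_plus (to_mg G)) = boxsize G.
Proof. by apply: eq_bigr => e _; rewrite !ffunE. Qed.

Lemma mg_prod_le_ex (n s q : nat) (G : multigraph 'I_n) : 2 <= s <= n ->
  is_sq_graph s q G -> mg_prod G <= ex_prod n s q.
Proof.
move=> sn GF; rewrite /ex_prod; apply: (@leq_bigmax_seq _ _ xpredT) => //.
by rewrite in_fset_set; [exact: mem_set|exact: finite_sq_graphs].
Qed.

(** Lowering all multiplicities of a multigraph counted by [ex_prod] by one
    leaves an (s,q)-graph, and so does lowering them further. *)
Lemma ex_prod_le_card (n s q : nat) : 2 <= s <= n ->
  ex_prod n s (q + 'C(s, 2)) <= #|sq_set 'I_n s q|.
Proof.
move=> sn; rewrite /ex_prod; apply/bigmax_leqP_seq => H.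
rewrite in_fset_set; last exact: finite_sq_graphs.
move=> /set_mem HF _.
have [->//|H0] := posnP (mg_prod H).
have H1 e : 0 < H e.
  by rewrite lt0n; apply: contraTneq H0 => He; rewrite /mg_prod (bigD1 e)//= He.
pose H' : multigraph 'I_n := [ffun e => (H e).-1].
have H'F : is_sq_graph s q H'.
  move=> X cX; rewrite -(leq_add2r 'C(s, 2)).
  apply: leq_trans (HF X cX); rewrite -cX -card_pairs_in -sum1_card /weight_in.
  rewrite [X in _ + X](eq_bigl (fun e : pairs 'I_n => val e \subset X)) => [|e]; last by rewrite inE.
  by rewrite -big_split /=; apply: leq_sum => e _; rewrite ffunE addn1 prednK.
have H'q : forall e, H' e <= q by apply: (sq_graph_le _ H'F); rewrite card_ord.
pose C : {ffun pairs 'I_n -> 'I_q.+1} := [ffun e => inord (H' e)].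
have CE e : C e = (H e).-1 :> nat by rewrite ffunE inordK ?ltnS ?H'q// ffunE.
have -> : mg_prod H = boxsize C by apply: eq_bigr => e _; rewrite CE prednK.
rewrite -card_below; apply/subset_leq_card/fintype.subsetP => G.
rewrite inE => /belowP GC; apply/sq_setP => X cX.
apply: leq_trans (H'F X cX); apply: leq_sum => e _.
by rewrite ffunE (leq_trans (GC e))// CE ffunE.
Qed.

End SqGraphs.

(** * The proportion of (s,q)-graphs below near-extremal ones *)

Section Assembly.
Local Open Scope ring_scope.
Variables (R : realType).

(** A limit exceeding [1] is a genuine limit. *)
Lemma ex_prod_lim_cvg (s q : nat) : 1 < ex_prod_lim R s q ->
  ((fun n : nat => (ex_prod n s q)%:R `^ ('C(n, 2)%:R^-1)) @ \oo --> ex_prod_lim R s q)%classic.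
Proof.
move=> lim1; have [//|/dvgP lim0] :=
  pselect (cvgn (fun n : nat => (ex_prod n s q)%:R `^ ('C(n, 2)%:R^-1) : R)).
(* The limit of a divergent sequence is [point], which is [0] in [R]. *)
by move: lim1; rewrite /ex_prod_lim lim0 /point /= ltr10.
Qed.

Lemma ln_root_ex_prod (n s q : nat) : (2 <= n)%N ->
  ln (ex_prod n s q)%:R =
  'C(n, 2)%:R * ln ((ex_prod n s q)%:R `^ ('C(n, 2)%:R^-1)) :> R.
Proof.
by move=> n2; rewrite ln_powR mulrA divff ?mul1r// pnatr_eq0 -lt0n bin_gt0.
Qed.

(** The extremal product bounds the logarithmic box size of (s,q)-graphs on [m]
    vertices, because [H^+] is an (s, q + 'C(s, 2))-graph. *)
Lemma ex_prod_weight (m s q : nat) (H : multigraph 'I_m) : (2 <= s <= m)%N ->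
  is_sq_graph s q H ->
  \sum_k ln ((H k).+1%:R) <= ln (ex_prod m s (q + 'C(s, 2)))%:R :> R.
Proof.
move=> sm HF.
have Hq : forall e, (H e <= q)%N by apply: (sq_graph_le _ HF); rewrite card_ord.
pose C : {ffun pairs 'I_m -> 'I_q.+1} := [ffun e => inord (H e)].
have CE e : C e = H e :> nat by rewrite ffunE inordK ?ltnS.
have -> : \sum_k ln ((H k).+1%:R) = ln (boxsize C)%:R :> R.
  by rewrite ln_boxsize; apply: eq_bigr => k _; rewrite CE.
have le : (boxsize C <= ex_prod m s (q + 'C(s, 2)))%N.
  rewrite -mg_prod_plus; apply: mg_prod_le_ex => //; apply: mg_plus_sq_graph.
  by rewrite (_ : to_mg C = H)//; apply/ffunP => e; rewrite ffunE CE.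
have b0 : (0 < boxsize C)%N by rewrite prodn_gt0.
by rewrite ler_ln ?posrE ?ltr0n ?ler_nat// (leq_trans b0).
Qed.

Lemma stuck_below_le (I : finType) (q r B p : nat)
    (F : {set {ffun I -> 'I_q.+1}}) (C : {ffun I -> 'I_q.+1}) (lam : R) :
  (q < B)%N -> (forall C, C \notin F -> exists2 S : {set I}, (#|S| <= r)%N &
    forall G, agree S G C -> G \notin F) ->
  expR (- lam) = (B ^ r).-1%:R / (B ^ r)%:R ->
  #|[set G in stuck B F C (r * p) | below G C]|%:R <=
  expR (ln (boxsize C)%:R - lam * p%:R) :> R.
Proof.
move=> qB Floc lamE.
have D0 : 0 < (B ^ r)%:R :> R by rewrite ltr0n expn_gt0 (leq_trans _ qB).
have := stuck_below_count qB Floc p C.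
rewrite -(ler_nat R) !natrM !(natrX _ _ p) -ler_pdivlMr ?exprn_gt0//.
rewrite -mulrA -expr_div_n -lamE => /le_trans; apply.
rewrite expRD lnK ?posrE ?ltr0n ?prodn_gt0//.
by rewrite -mulNr expRM_natr.
Qed.

Lemma natr_bin2 (n : nat) : 'C(n, 2)%:R = (n%:R ^+ 2 - n%:R) / 2 :> R.
Proof.
elim: n => [|n IH]; first by rewrite expr0n /= subrr mul0r.
by rewrite binS natrD IH bin1 -natr1; field.
Qed.

(** The (s,q)-graphs that do not lie below a near-extremal one. *)
Definition bad_set (n s q : nat) (eps : R) : {set {ffun pairs 'I_n -> 'I_q.+1}} :=
  [set G | `[< (sq_graphs n s q `\` sub_near_ex_graphs n s q eps)%classic (to_mg G) >]].

Lemma bad_setP n s q (eps : R) G :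
  reflect ((sq_graphs n s q `\` sub_near_ex_graphs n s q eps)%classic (to_mg G))
    (G \in bad_set n s q eps).
Proof. by rewrite /bad_set finset.in_set; exact: asboolP. Qed.

(** In a large box, whatever is not below a near-extremal graph is stuck. *)
Lemma bad_below_stuck n s q (eps : R) (B k : nat) (C : {ffun pairs 'I_n -> 'I_q.+1}) :
  ex_prod_lim R s (q + 'C(s, 2)) `^ ((1 - eps) * 'C(n, 2)%:R) * (B ^ k)%:R
    < (boxsize C)%:R -> (0 < B)%N ->
  [set G in bad_set n s q eps | below G C] \subset
  [set G in stuck B (sq_set 'I_n s q) C k | below G C].
Proof.
move=> big B0; apply/fintype.subsetP => G.
rewrite finset.in_set [in X in _ -> X]finset.in_set => /andP[/bad_setP[GF nE] GC].
rewrite GC andbT finset.in_set; apply/andP; split; first exact/sq_setP.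
apply/negP => /existsP[G' /andP[/sq_setP G'F /andP[/belowP GG' le]]].
apply: nE; split => //; exists (to_mg G'); last by move=> e; rewrite !ffunE.
split => //; rewrite mg_prod_plus.
have Bk : 0 < (B ^ k)%:R :> R by rewrite ltr0n expn_gt0 B0.
rewrite -(ltr_pM2r Bk) -natrM; apply: lt_le_trans big _.
by rewrite ler_nat.
Qed.

(** Counting container by container. *)
Lemma card_bad_le n s q (eps : R) (CC : {set {ffun pairs 'I_n -> 'I_q.+1}}) :
  (forall G : {ffun pairs 'I_n -> 'I_q.+1}, is_sq_graph s q (to_mg G) ->
    exists2 C, C \in CC & below G C) ->
  (#|bad_set n s q eps| <= \sum_(C in CC) #|[set G in bad_set n s q eps | below G C]|)%N.
Proof.
move=> cov; rewrite -sum1_card.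
under [leqRHS]eq_bigr do rewrite -sum1_card.
rewrite (exchange_big_dep (mem (bad_set n s q eps))) /=; last first.
  by move=> C G _; rewrite finset.in_set => /andP[].
apply: leq_sum => G Gbad; have /bad_setP[GF _] := Gbad.
have [C CCC GC] := cov G GF.
by rewrite (bigD1 C)//= CCC finset.in_set Gbad.
Qed.

End Assembly.

Unset Implicit Arguments.
Set Strict Implicit.
Local Open Scope classical_set_scope.
Local Open Scope ring_scope.

Theorem theorem2 (R : realType) (s q : nat) (hs : (2 <= s)%N)
    (hex : 1 < ex_prod_lim R s (q + 'C(s, 2))) :
  forall eps : R, 0 < eps ->
  exists2 beta : R, 0 < beta &
    \forall n \near \oo,
      (card_set (sq_graphs n s q `\` sub_near_ex_graphs n s q eps))%:R
        / (card_set (sq_graphs n s q))%:R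
      <= 2 `^ (- beta * n%:R ^+ 2).
Proof.
have arith1 (b L g nn lam p kap : R) : b <= ((L + g) / 2 + g) * nn ->
    2 * lam <= g * nn -> 8 * g * nn <= lam * kap * nn -> lam * (kap * nn) <= lam * (p + 1) ->
    b - lam * p <= L * nn / 2 - 6 * g * nn by move=> ? ? ? ?; nra.
have arith2 (eps L rl p n nn g : R) : rl * p <= eps * L / 8 * nn ->
    eps * L * (2 * n) <= eps * L * nn -> 0 <= n * L -> 8 * g * nn <= eps * L / 8 * nn ->
    0 <= g * nn ->
    (1 - eps) * ((nn - n) / 2) * L + rl * p <= L * nn / 2 - 6 * g * nn.
  by move=> ? ? ? ? ?; nra.
have arith3 (L n nn g : R) : n * L <= g * nn -> 0 <= g * n -> 0 <= g * nn ->
    g * nn + (L * nn / 2 - 6 * g * nn) <= - 3 * g * nn + (nn - n) / 2 * (L - g).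
  by move=> ? ? ?; nra.
move=> eps eps0.
have cv := ex_prod_lim_cvg hex.
set r := 'C(s, 2) in hex cv *.
set Q := (q + r)%N in hex cv *.
set pi := ex_prod_lim R s Q in hex cv *.
pose u (n : nat) : R := (ex_prod n s Q)%:R `^ ('C(n, 2)%:R^-1).
have pi0 : 0 < pi by exact: lt_trans hex.
pose lnpi := ln pi.
have lnpi0 : 0 < lnpi by rewrite ln_gt0.
have r0 : (0 < r)%N by rewrite bin_gt0.
(* [q.+2] rather than [q.+1], so that [D > 1] also when [q = 0]. *)
pose B := q.+2; pose D := (B ^ r)%N.
have D1 : (1 < D)%N by rewrite -(exp1n r) ltn_exp2r.
pose lam := - ln (D.-1%:R / D%:R) : R.
have D0 : 0 < D%:R :> R by rewrite ltr0n ltnW.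
have D'0 : 0 < D.-1%:R :> R by rewrite ltr0n -ltnS prednK// ltnW.
have x0 : 0 < D.-1%:R / D%:R :> R by rewrite divr_gt0.
have lamE : expR (- lam) = D.-1%:R / D%:R by rewrite opprK lnK.
have lam0 : 0 < lam.
  by rewrite oppr_gt0 ln_lt0// x0 /= ltr_pdivrMr// mul1r ltr_nat ltn_predL ltnW.
pose lnB : R := ln B%:R.
have lnB0 : 0 <= lnB by rewrite ln_ge0// ler1n.
(* The decision trees have depth [p], about [kap * n ^ 2]: this loses a factor
   of at most [pi ^ (eps * n ^ 2 / 8)] in the box size, and gains one of
   [expR (- lam * p)] in the count. *)
pose kap := eps * lnpi / (8 * (1 + r%:R * lnB)).
have rB0 : 0 < 1 + r%:R * lnB by rewrite ltr_pwDl// mulr_ge0.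
have kap0 : 0 < kap by rewrite divr_gt0 ?mulr_gt0.
pose gam := Num.min (lam * kap) (eps * lnpi / 8) / 8.
have gam0 : 0 < gam.
  by rewrite divr_gt0// lt_min (mulr_gt0 lam0 kap0) /= divr_gt0// mulr_gt0.
have gam1 : 8 * gam <= lam * kap.
  by rewrite mulrC /gam mulfVK// ge_min lexx.
have gam2 : 8 * gam <= eps * lnpi / 8.
  by rewrite mulrC /gam mulfVK// ge_min lexx orbT.
have kapB : kap * (r%:R * lnB) <= eps * lnpi / 8.
  have -> : kap * (r%:R * lnB) = eps * lnpi / 8 * (r%:R * lnB / (1 + r%:R * lnB)).
    by rewrite /kap; field; rewrite gt_eqF.
  have el0 : 0 <= eps * lnpi / 8 by rewrite divr_ge0// mulr_ge0// ltW.
  by rewrite ler_piMr// ler_pdivrMr// mul1r lerDr.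
(* A number of vertices on which the extremal root is close to its limit. *)
have [m [sm um1 um2]] : exists m, [/\ (2 <= s <= m)%N, 1 < u m & u m < pi * expR gam].
  suff /filter_ex : \forall m \near \oo,
    [/\ (2 <= s <= m)%N, 1 < u m & u m < pi * expR gam] by [].
  near=> m; split.
  - by rewrite hs /=; near: m; exact: nbhs_infty_ge.
  - by near: m; exact: cvgr_gt cv _ hex.
  - near: m; apply: cvgr_lt cv _ _.
    by rewrite -[ltLHS]mulr1 ltr_pM2l// expR_gt1.
have m2 : (2 <= m)%N by case/andP: sm => /leq_trans; apply.
have U0 : (0 < #|{: pairs 'I_m}|)%N by rewrite card_pairs bin_gt0.
have L0 : 0 <= lnpi + gam by rewrite addr_ge0 ?ltW.
have HL (H : multigraph 'I_m) : is_sq_graph s q H ->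
    \sum_k ln ((H k).+1%:R) <= #|{: pairs 'I_m}|%:R * (lnpi + gam).
  move=> /(ex_prod_weight R sm)/le_trans; apply.
  rewrite ln_root_ex_prod// card_pairs ler_wpM2l// -/r -/Q -/(u m).
  rewrite -[gam]expRK -lnM ?posrE ?expR_gt0// ler_ln ?posrE ?mulr_gt0 ?expR_gt0//.
    exact: ltW.
  exact: lt_trans um1.
have [n0 cont] := container_theorem gam0 L0 U0 HL.
have ln2 : 0 < ln 2 :> R by rewrite ln_gt0// ltr1n.
exists (3 * gam / ln 2); first by rewrite divr_gt0// mulr_gt0.
near=> n.
have sn : (2 <= s <= n)%N by rewrite hs /=; near: n; exact: nbhs_infty_ge.
have n2 : (2 <= n)%N by case/andP: sn => /leq_trans; apply.
have nn0 : (n0 <= n)%N by near: n; exact: nbhs_infty_ge.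
have nlam : 2 * lam <= n%:R * gam.
  by rewrite -ler_pdivrMr//; near: n; exact: nbhs_infty_ger.
have nlnpi : lnpi <= n%:R * gam.
  by rewrite -ler_pdivrMr//; near: n; exact: nbhs_infty_ger.
have un : pi * expR (- gam) < u n.
  near: n; apply: cvgr_gt cv _ _.
  by rewrite -[ltRHS]mulr1 ltr_pM2l// expR_lt1 oppr_lt0.
have := cont 'I_n; rewrite card_ord => /(_ nn0) [CC [CCcard CCbox CCcov]].
set nn := n%:R ^+ 2 in CCcard CCbox *.
have nR : 2 <= n%:R :> R by rewrite ler_nat.
have NE := natr_bin2 R n; rewrite -/nn in NE.
have nnE : nn = n%:R * n%:R by rewrite /nn expr2.
have le_lam : 2 * lam <= gam * nn by rewrite nnE; nra.
have le_lnpi : n%:R * lnpi <= gam * nn by rewrite nnE; nra.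
have nn0' : 0 <= nn by rewrite exprn_ge0.
pose p := Num.truncn (kap * nn).
have p1 : p%:R <= kap * nn by rewrite truncn_le// mulr_ge0// ltW.
have p2 : kap * nn < p%:R + 1 by rewrite natr1 truncnS_gt.
pose SA := bad_set n s q eps.
(* A container of large box has few bad graphs, because these are stuck; a
   container of small box has few members altogether. *)
have each C : C \in CC -> #|[set G in SA | below G C]%SET|%:R <=
    expR (lnpi * nn / 2 - 6 * gam * nn).
  move=> CCC; have box := CCbox C CCC.
  have [big|small] := ltP (pi `^ ((1 - eps) * 'C(n, 2)%:R) * (B ^ (r * p))%:R)
    (boxsize C)%:R.
    apply: (@le_trans _ _ (expR (ln (boxsize C)%:R - lam * p%:R))).
      have qB : (q < B)%N by rewrite ltnW.
      apply: le_trans (@stuck_below_le R _ q r B p _ C lam qB (@sq_set_local _ s q) lamE).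
      by rewrite ler_nat; apply/subset_leq_card/bad_below_stuck.
    rewrite ler_expR.
    exact: arith1 box le_lam (ler_wpM2r nn0' gam1) (ler_wpM2l (ltW lam0) (ltW p2)).
  apply: (@le_trans _ _ (boxsize C)%:R).
    rewrite -card_below ler_nat; apply/subset_leq_card/fintype.subsetP => G.
    by rewrite finset.in_set => /andP[_ GC]; rewrite finset.in_set.
  apply: le_trans small _.
  have -> : pi `^ ((1 - eps) * 'C(n, 2)%:R) = expR ((1 - eps) * 'C(n, 2)%:R * lnpi).
    by rewrite /powR gt_eqF.
  have -> : (B ^ (r * p))%:R = expR (r%:R * lnB * p%:R) :> R.
    by rewrite expnM !natrX expRM_natr expRM_natl /lnB lnK ?posrE ?ltr0n.
  rewrite -expRD ler_expR NE.
  have rl0 : 0 <= r%:R * lnB by rewrite mulr_ge0.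
  have el0 : 0 <= eps * lnpi by rewrite mulr_ge0// ltW.
  apply: (@arith2 eps lnpi (r%:R * lnB) p%:R n%:R nn gam).
  - by rewrite (le_trans (ler_wpM2l rl0 p1))// mulrA [r%:R * _ * kap]mulrC ler_wpM2r.
  - have n2nn : 2 * n%:R <= nn by rewrite nnE ler_pM2r// ltr0n ltnW.
    by rewrite ler_wpM2l.
  - by rewrite mulr_ge0// ltW.
  - by rewrite ler_wpM2r.
  - by rewrite mulr_ge0// ltW.
have SAF : (card_set (sq_graphs n s q `\` sub_near_ex_graphs n s q eps))%:R = #|SA|%:R :> R.
  by rewrite (card_set_sq (q := q) sn)//; exact: subDsetl.
have FE : (card_set (sq_graphs n s q))%:R = #|sq_set 'I_n s q|%:R :> R.
  by rewrite (card_set_sq (q := q) sn).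
have exF : expR ('C(n, 2)%:R * (lnpi - gam)) <= #|sq_set 'I_n s q|%:R.
  have ex0 : 0 < (ex_prod n s Q)%:R :> R.
    rewrite lt0r ler0n andbT; apply: contraTN un => /eqP ex0.
    rewrite /u ex0 powR0 ?invr_eq0 ?pnatr_eq0 -?lt0n ?bin_gt0//.
    by rewrite -leNgt mulr_ge0 ?expR_ge0// ltW.
  have un0 : 0 < pi * expR (- gam) by rewrite mulr_gt0 ?expR_gt0.
  apply: (@le_trans _ _ (ex_prod n s Q)%:R); last by rewrite ler_nat ex_prod_le_card.
  rewrite -[leRHS]lnK ?posrE// ler_expR ln_root_ex_prod// ler_wpM2l//.
  rewrite -/(u n).
  rewrite -[- gam]expRK -lnM ?posrE ?expR_gt0// ler_ln ?posrE//.
    exact: ltW.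
  exact: lt_trans un.
rewrite SAF FE ler_pdivrMr; last by apply: lt_le_trans exF; exact: expR_gt0.
have -> : 2 `^ (- (3 * gam / ln 2) * nn) = expR (- 3 * gam * nn).
  rewrite /powR pnatr_eq0 /=; congr expR; field; exact: lt0r_neq0.
apply: (@le_trans _ _ (expR (- 3 * gam * nn) * expR ('C(n, 2)%:R * (lnpi - gam)))); last first.
  by rewrite ler_pM2l ?expR_gt0.
apply: (@le_trans _ _ (\sum_(C in CC) expR (lnpi * nn / 2 - 6 * gam * nn))).
  have := card_bad_le eps CCcov; rewrite -(ler_nat R) natr_sum => /le_trans; apply.
  exact: ler_sum.
rewrite sumr_const -[leLHS]mulr_natl -expRD.
apply: le_trans (ler_wpM2r (expR_ge0 _) CCcard) _.
rewrite -expRD ler_expR NE.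
by apply: arith3 => //; rewrite mulr_ge0// ltW.
Unshelve. all: by end_near.
Qed.
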